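(* For every $\beta \geq 1$ the following hold. (1) ($k$-center) For every $\epsilon \in (0,1/2)$ there is an online algorithm for fully dynamic $k$-center that at every time $t$ maintains a set of at most $(1+\epsilon)k$ centers that is an $O(\beta)$-approximate solution at time $t$, and whose total recourse is at most $O\!\left(\frac{1}{\epsilon^2}\log\frac{|F|}{\epsilon}\log \Delta\right)\cdot \mathrm{OPT}_{\mathrm{rec}}^{\beta}$. (2) (facility location) There is an online algorithm for fully dynamic facility location that maintains an $O(\beta)$-approximate solution at every time and whose total recourse is at most $O(\log |F| \log \Delta)\cdot \mathrm{OPT}_{\mathrm{rec}}^{\beta}$. (3) ($k$-median) There is an online algorithm for fully dynamic $k$-median that at every time maintains a set of $O(k)$ centers that is an $O(\beta)$-approximate solution, and whose total recourse is at most $O(\log |F| \log \Delta)\cdot \mathrm{OPT}_{\mathrm{rec}}^{\beta}$.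
   Context: A finite metric space $(M,d)$ is given, normalized so that $\min_{i\neq j} d_{ij}=1$; $\Delta=\max_{i,j\in M} d_{ij}$ is its aspect ratio. $F\subseteq M$ is the set of candidate center (facility) locations; for $k$-center and $k$-median $F=M$. At each time $t=1,\dots,T$ a set of clients $C^t\subseteq M$ is present (clients arrive and depart over time), and an online algorithm must, after seeing $C^t$, output a set $S^t\subseteq F$ of open centers, with $S^0=\emptyset$. Objectives at time $t$: in $k$-center, $|S^t|\le k$ is allowed for the optimum and the cost is $\max_{j\in C^t}\min_{i\in S^t} d_{ij}$; in facility location, each $i\in F$ has opening cost $f_i\ge 0$, any number of facilities may be opened, and the cost is $\sum_{i\in S^t} f_i+\sum_{j\in C^t}\min_{i\in S^t} d_{ij}$; in $k$-median the optimum may open at most $k$ centers and the cost is $\sum_{j\in C^t}\min_{i\in S^t} d_{ij}$. A solution is $\gamma$-approximate at time $t$ if its cost is at most $\gamma$ times the optimal cost at time $t$ (optimum over solutions with at most $k$ centers for $k$-center and $k$-median). The total recourse of a sequence of solutions is $\sum_{t=1}^T |S^t\oplus S^{t-1}|$ (symmetric differences). $\mathrm{OPT}_{\mathrm{rec}}^{\beta}$ denotes the minimum total recourse of an offline algorithm (knowing the whole sequence in advance) that maintains a $\beta$-approximate solution (with at most $k$ centers, for $k$-center and $k$-median) at every time.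
   Formalization: The factor log Δ is read as 1 + log Δ in all three parts, and log |F| as 1 + log |F| in facility location, because the literal bounds vanish when Δ = 1 or |F| = 1 although opening a center is unavoidable; for Δ, |F| at least 2 this changes only the constant. *)

(* Defs.v *)
From mathcomp Require Export all_boot all_order all_algebra.
From mathcomp Require Export all_classical all_reals all_analysis.

Set Implicit Arguments.
Unset Strict Implicit.
Unset Printing Implicit Defensive.

Import Order.TTheory GRing.Theory Num.Theory.

Local Open Scope ring_scope.

Section Metric.
Context {R : realType} {M : finType}.
Implicit Type d : M -> M -> R.

Record is_metric d : Prop := IsMetric {
  metric_ge0 : forall x y, 0 <= d x y;
  metric_eq0 : forall x y, d x y = 0 <-> x = y;
  metric_sym : forall x y, d x y = d y x;
  metric_triangle : forall x y z, d x z <= d x y + d y z }.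

(* The minimum over an empty index set is +oo, so this also forces M to have
   at least two points. *)
Definition normalized d : Prop :=
  \big[mine/+oo%E]_(p : M * M | p.1 != p.2) (d p.1 p.2)%:E = 1%E.

Definition aspect_ratio d : R := \big[Num.max/0]_(p : M * M) d p.1 p.2.

End Metric.

(* In the three objectives, C is the set of clients and S the set of open
   centers. A client has connection cost +oo when S is empty; with no client,
   the k-center cost is 0. *)
Section Objectives.
Context {R : realType} {M : finType}.
Implicit Types (d : M -> M -> R) (C S : {set M}).
Local Open Scope ereal_scope.

Definition connection_cost d S (j : M) : \bar R :=
  \big[mine/+oo]_(i in S) (d i j)%:E.

Definition kcenter_cost d C S : \bar R :=
  \big[maxe/0]_(j in C) connection_cost d S j.

Definition kmedian_cost d C S : \bar R :=
  \sum_(j in C) connection_cost d S j.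

Definition facility_cost d (f : M -> R) C S : \bar R :=
  \sum_(i in S) (f i)%:E + \sum_(j in C) connection_cost d S j.

End Objectives.

Definition centers_in {M : finType} (F : {set M}) : pred {set M} :=
  fun S => S \subset F.

Definition at_most_centers {R : realType} {M : finType} (F : {set M}) (b : R) :
    pred {set M} :=
  fun S => (S \subset F) && (#|S|%:R <= b).

(* Time t = 1, ..., T is represented by the index t - 1 of a T-tuple. *)
Section Dynamic.
Context {R : realType} {M : finType}.
Variables (cost : {set M} -> {set M} -> \bar R) (feas : pred {set M}).
Implicit Types C S : {set M}.

Definition opt_cost C : \bar R := \big[mine/+oo%E]_(S | feas S) cost C S.

Definition approximate (gamma : R) C S : bool :=
  (cost C S <= gamma%:E * opt_cost C)%E.

Definition recourse (T : nat) (s : T.-tuple {set M}) : nat :=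
  (\sum_(t < T)
    let new := nth finset.set0 s t in
    let old := nth finset.set0 (finset.set0 :: s) t in
    #|(new :\: old) :|: (old :\: new)|)%N.

Definition opt_recourse (beta : R) (T : nat) (c : T.-tuple {set M}) : \bar R :=
  \big[mine/+oo%E]_(s : T.-tuple {set M} |
      [forall t : 'I_T, feas (tnth s t) &&
                        approximate beta (tnth c t) (tnth s t)])
    (recourse s)%:R%:E.

(* An online algorithm maps the history C^1, ..., C^t to S^t; in particular it
   does not know the horizon T. *)
Definition online_algorithm := seq {set M} -> {set M}.

Definition run (A : online_algorithm) (T : nat) (c : T.-tuple {set M}) :
    T.-tuple {set M} :=
  [tuple A (take t.+1 c) | t < T].

(* The algorithm outputs sets satisfying [allowed], whereas both the optimal
   cost and the offline recourse range over sets satisfying [feas]. *)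
Definition competitive (allowed : pred {set M}) (gamma beta rho : R) : Prop :=
  exists A : online_algorithm, forall (T : nat) (c : T.-tuple {set M}),
    (forall t : 'I_T, allowed (tnth (run A c) t) /\
       approximate gamma (tnth c t) (tnth (run A c) t)) /\
    ((recourse (run A c))%:R%:E <= rho%:E * opt_recourse beta c)%E.

End Dynamic.

(* Main.v *)
(* From the clients at time t one gets a family V of admissible center sets, of
   which the offline solution picks one.  A fractional solution z chases V: as
   long as z violates a covering (resp. packing) inequality satisfied by all of
   V with a constant (resp. 1 + eps) gap, z is increased (resp. decreased)
   multiplicatively.  Each such step decreases the relative entropy between the
   offline set and z by at least eps / 4 times the l1 movement, while a change of
   one offline center increases it by O(log (n / eps)).

   The rounding depends on z only, not on the clients.  Let rad 0 = 0 and
   rad (l + 1) = 2 ^ l; a site is a pair (i, l), standing for the ball of center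
   i and radius rad l.  It suffices to open O(z(M)) centers such that every ball
   of mass at least 1/4 (or 1 - eps) has one within O(rad l).  The sites of one
   level can be kept disjoint and stable at a cost proportional to the movement
   of z, which is where the factor log Delta comes from.
   - For sums of connection costs, the net of all levels is split into classes
     according to the opening cost of the cheapest facility of the ball, and each
     class is thinned out to disjoint balls whenever it is three times too large.
   - For k-center, the (1 + eps) k bound on the number of centers leaves no room
     for constant factors: heavy sites are only added, a small site evicting the
     larger ones it meets, and everything is rebuilt once z has moved by eps k. *)

Require Import Defs.
From mathcomp Require Import fintype finset ring lra zify.

Set Implicit Arguments.
Unset Strict Implicit.
Unset Printing Implicit Defensive.

Import Order.TTheory GRing.Theory Num.Theory.
Local Open Scope ring_scope.

(** * Symmetric differences *)

Definition symdiff (T : finType) (A B : {set T}) : {set T} :=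
  (A :\: B) :|: (B :\: A).

Lemma card_symdiff (T : finType) (A B : {set T}) :
  #|symdiff A B| = (#|A :\: B| + #|B :\: A|)%N.
Proof.
rewrite /symdiff cardsU [X in (_ - X)%N](_ : _ = 0%N) ?subn0 //; apply/eqP.
rewrite cards_eq0; apply/eqP/setP => x; rewrite !inE.
by case: (x \in A); case: (x \in B).
Qed.

Lemma symdiff_triangle (T : finType) (A B C : {set T}) :
  (#|symdiff A C| <= #|symdiff A B| + #|symdiff B C|)%N.
Proof.
apply: leq_trans (leq_card_setU _ _); apply/subset_leq_card/subsetP => x.
by rewrite !inE; case: (x \in A); case: (x \in B); case: (x \in C).
Qed.

Lemma card_symdiff_imset (I T : finType) (f : I -> T) (A B : {set I}) :
  (#|symdiff (f @: A) (f @: B)| <= #|symdiff A B|)%N.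
Proof.
apply: leq_trans (leq_imset_card f _); apply: subset_leq_card.
apply/subsetP => s; rewrite !inE => /orP[] /andP[ns /imsetP[q qA es]];
  rewrite es; apply: imset_f.
  have nB : q \notin B by apply: contra ns => qB; rewrite es imset_f.
  by rewrite !inE qA (negPf nB).
have nA : q \notin A by apply: contra ns => qA'; rewrite es imset_f.
by rewrite !inE qA (negPf nA).
Qed.

(** * Fractional chasing *)

Section FractionalChasing.
Context {R : realType} {M : finType}.
Implicit Types (u : {set M}) (z c p : M -> R).

Definition l1dist z z' : R := \sum_i `|z i - z' i|.

Lemma ln_le_subr1 (x : R) : 0 < x -> ln x <= x - 1.
Proof. by move=> x0; rewrite -{1}(subrKC 1 x) le_ln1Dx //; lra. Qed.

Variable gam : R.

(* The relative entropy u ln (u / y) - u + y at u = b and y = x + gam, lowered by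
   gam when b = 0 so that the initial potential vanishes. *)
Definition entropy (b : bool) (x : R) : R :=
  if b then x + gam - 1 - ln (x + gam) else x.

Definition divergence u z : R := \sum_i entropy (i \in u) (z i).

Hypotheses (gam0 : 0 < gam) (gam1 : gam <= 1).

Lemma entropy_ge0 b (x : R) : 0 <= x -> 0 <= entropy b x.
Proof.
have [g0 g1] := (gam0, gam1).
move=> x0; case: b => //=; have y0 : 0 < x + gam by lra.
by have h := ln_le_subr1 y0; lra.
Qed.

(** Adding an element costs at most [- ln gam], because [x + gam >= gam]; removing one costs at most
    [x <= 2], which is why [z] is capped. *)
Lemma entropy_switch b b' (x : R) : 0 <= x -> x <= 2 ->
  entropy b x <= entropy b' x + (3 - ln gam) * (b (+) b')%:R.
Proof.
have [g0 g1] := (gam0, gam1).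
move=> x0 x2; have lng : ln gam <= 0 by rewrite ln_le0.
have h1 : ln gam <= ln (x + gam) by rewrite ler_ln ?posrE; lra.
have y0 : 0 < x + gam by lra.
have h2 := ln_le_subr1 y0.
case: b; case: b' => /=; rewrite ?mulr0 ?mulr1; lra.
Qed.

Lemma divergence_ge0 u z : (forall i, 0 <= z i) -> 0 <= divergence u z.
Proof. by move=> z0; apply: sumr_ge0 => i _; apply: entropy_ge0. Qed.

Lemma divergence_switch u u' z : (forall i, 0 <= z i <= 2) ->
  divergence u z <= divergence u' z + (3 - ln gam) * #|symdiff u u'|%:R.
Proof.
have [g0 g1] := (gam0, gam1).
move=> zb; rewrite -sum1_card big_mkcond /= natr_sum mulr_sumr -big_split /=.
apply: ler_sum => i _; have /andP[z0 z2] := zb i.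
apply: le_trans (entropy_switch (i \in u) (i \in u') z0 z2) _.
by rewrite !inE; case: (i \in u); case: (i \in u').
Qed.

(** The step multiplies [x + gam] by [1 + s * c]; then [ln (1 + v) >= v / (1 + v)] is applied with
    [v = s * c <= 2 * s]. *)
Lemma entropy_cover b (x c s : R) : 0 <= x -> 0 <= c <= 2 -> 0 <= s ->
  entropy b (x + s * c * (x + gam)) <=
  entropy b x + s * (c * (x + gam)) - s * (1 - 2 * s) * (if b then c else 0).
Proof.
have [g0 g1] := (gam0, gam1).
move=> x0 /andP[c0 c2] s0; case: b => /=; last by rewrite mulr0 subr0 mulrA.
have v0 : 0 <= s * c by rewrite mulr_ge0.
have -> : x + s * c * (x + gam) + gam = (x + gam) * (1 + s * c) by ring.
rewrite lnM ?posrE; [|lra..].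
have h : s * c * (1 - 2 * s) <= ln (1 + s * c).
  have v1 : 0 < 1 + s * c by lra.
  have := @ln_le_subr1 (1 + s * c)^-1; rewrite invr_gt0 => /(_ v1).
  rewrite lnV ?posrE; last lra.
  have -> : (1 + s * c)^-1 - 1 = - (s * c / (1 + s * c)).
    by field; apply/eqP; lra.
  rewrite lerN2; apply: le_trans; rewrite ler_pdivlMr; last lra.
  rewrite -[leRHS]mulr1 -[leLHS]mulrA ler_wpM2l //.
  have h : s * c <= 2 * s by rewrite mulrC ler_wpM2r.
  nra.
lra.
Qed.

(** Here [x] itself, not [x + gam], is scaled by [1 - s * p], which keeps it nonnegative; [x + gam]
    then shrinks by no more than that factor. *)
Lemma entropy_pack b (x p s : R) : 0 <= x -> 0 <= p <= 1 -> 0 <= s <= 1 / 4 ->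
  entropy b (x - s * p * x) <=
  entropy b x - s * (p * x) + s * (1 + 2 * s) * (if b then p else 0).
Proof.
have [g0 g1] := (gam0, gam1).
move=> x0 /andP[p0 p1] /andP[s0 s1]; case: b => /=; last by rewrite mulr0 addr0 mulrA.
have v0 : 0 <= s * p by rewrite mulr_ge0.
have v1 : s * p <= s by rewrite ler_piMr.
have h : - (s * p * (1 + 2 * s)) <= ln (1 - s * p).
  have w1 : 0 < 1 - s * p by lra.
  have := @ln_le_subr1 (1 - s * p)^-1; rewrite invr_gt0 => /(_ w1).
  rewrite lnV ?posrE; last lra.
  have -> : (1 - s * p)^-1 - 1 = s * p / (1 - s * p).
    by field; apply/eqP; lra.
  move=> h; rewrite lerNl; apply: le_trans h _; rewrite ler_pdivrMr; last lra.
  rewrite -[leLHS]mulr1 -[leRHS]mulrA ler_wpM2l //; nra.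
have : ln ((x + gam) * (1 - s * p)) <= ln (x - s * p * x + gam).
  by rewrite ler_ln ?posrE; nra.
by rewrite lnM ?posrE => *; lra.
Qed.

Variables (eps : R) (A : {set M}) (V : pred {set M}).
Hypotheses (eps0 : 0 < eps) (eps1 : eps <= 1).
Hypothesis gamA : 8 * gam * #|A|%:R <= eps.
Hypothesis VA : forall u, V u -> u \subset A.

Definition fractional z : Prop :=
  (forall i, 0 <= z i <= 2) /\ (forall i, i \notin A -> z i = 0).

(** The l1 term will pay for the rounding; a positive surplus [r], the same at each step, bounds the
    number of steps. *)
Definition progress z z' (r : R) : Prop := forall u, V u ->
  divergence u z' + eps / 4 * l1dist z' z + r <= divergence u z.

(* Coordinates that are already at least 1 are frozen, which keeps z below 2.
   Dropping them lowers c.z by at least as much as c.u, so the gap persists. *)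
Lemma cover_step z c : fractional z -> (forall i, 0 <= c i <= 2) ->
  (forall u, V u -> 1 <= \sum_(i in u) c i) -> \sum_i c i * z i <= 1 - eps ->
  exists2 z', fractional z' & progress z z' (eps ^+ 2 / 32).
Proof.
have [g0 g1] := (gam0, gam1); have [e0 e1] := (eps0, eps1).
move=> [zb zA] cb cu cz; pose s := eps / 8; have s0 : 0 < s by rewrite /s; lra.
pose w i := if (i \in A) && (z i < 1) then c i else 0.
pose big i := if (i \in A) && ~~ (z i < 1) then c i else 0.
have wb i : 0 <= w i <= 2 by rewrite /w; case: ifP => // _; rewrite lexx; lra.
have big0 i : 0 <= big i by rewrite /big; case: ifP => // _; case/andP: (cb i).
pose z' i := z i + s * w i * (z i + gam).
have mv i : 0 <= s * w i * (z i + gam).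
  have /andP[w0 _] := wb i; have /andP[x0 _] := zb i.
  by rewrite !mulr_ge0 //; lra.
exists z'.
  split=> i; last by move=> iA; rewrite /z' /w (negPf iA) /= mulr0 mul0r addr0 zA.
  have /andP[x0 x2] := zb i; have hm := mv i; apply/andP; split; first by rewrite /z'; lra.
  rewrite /z' /w; case: ifP => [/andP[_ x1]|_]; last by rewrite mulr0 mul0r addr0.
  have /andP[c0 c2] := cb i.
  have h : s * c i * (z i + gam) <= (1 / 8 * 2) * 2.
    by rewrite !ler_pM ?mulr_ge0 //; rewrite /s; lra.
  lra.
move=> u Vu.
have dist : l1dist z' z = s * \sum_i w i * (z i + gam).
  rewrite mulr_sumr; apply: eq_bigr => i _.
  by rewrite /z' addrC addKr ger0_norm // mulrA.
have D : divergence u z' <= divergence u z + s * \sum_i w i * (z i + gam)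
     - s * (1 - 2 * s) * \sum_(i in u) w i.
  rewrite /divergence [\sum_(i in u) _]big_mkcond !mulr_sumr -big_split -sumrB /=.
  apply: ler_sum => i _; have /andP[x0 _] := zb i.
  by apply: entropy_cover => //; rewrite ltW.
pose T := \sum_i big i.
have T0 : 0 <= T by apply: sumr_ge0.
have wz : \sum_i w i * z i <= 1 - eps - T.
  rewrite lerBrDr -big_split /=; apply: le_trans cz; apply: ler_sum => i _.
  rewrite /w /big; case: (boolP (i \in A)) => [iA|iA] /=.
  2: by rewrite zA // !mulr0 addr0.
  case: ltP => h; rewrite ?addr0 ?mul0r ?add0r // ler_peMr //.
  by case/andP: (cb i).
have wu : 1 - T <= \sum_(i in u) w i.
  rewrite lerBlDr; apply: le_trans (cu u Vu) _.
  rewrite /T [\sum_i big i](bigID (mem u)) /= addrA -big_split /= -[leLHS]addr0.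
  rewrite lerD //; last first.
    by apply: sumr_ge0.
  apply: ler_sum => i iu; rewrite /w /big (subsetP (VA Vu) _ iu) /=.
  by case: ltP => h; rewrite ?addr0 ?add0r.
have wg : \sum_i w i * gam <= eps / 4.
  have : \sum_i w i <= \sum_(i in A) 2.
    rewrite [leRHS]big_mkcond; apply: ler_sum => i _; rewrite /w.
    by case: (i \in A) => //=; case: ifP => // _; case/andP: (cb i).
  rewrite sumr_const -mulr_suml => h.
  have h2 : (\sum_i w i) * gam <= (2 *+ #|A|) * gam by rewrite ler_wpM2r // ltW.
  apply: le_trans h2 _; rewrite -mulr_natr.
  have := gamA; move=> ?; lra.
have sumE : \sum_i w i * (z i + gam) = \sum_i w i * z i + \sum_i w i * gam.
  by rewrite -big_split; apply: eq_bigr => i _; rewrite mulrDr.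
rewrite dist; rewrite sumE in D *.
set X := \sum_i w i * z i in D wz *; set Y := \sum_i w i * gam in D wg *.
set U := \sum_(i in u) w i in D wu.
have h1 : (1 - 2 * s) * (1 - T) <= (1 - 2 * s) * U by rewrite ler_wpM2l // /s; lra.
(* From [X + Y <= 1 - T - 3 * eps / 4] and [U >= 1 - T], the divergence drops by [s * eps / 2]. Half
   of this pays for the movement, which is at most [s]; half is the surplus. *)
have h2 : s * (X + Y - (1 - 2 * s) * U) <= s * (- (eps / 2)).
  rewrite ler_wpM2l ?(ltW s0) //; rewrite /s in h1 *; nra.
have h3 : eps / 4 * (s * (X + Y)) <= eps / 4 * (s * 1).
  by rewrite !ler_wpM2l //; lra.
have E : eps ^+ 2 / 32 = s * (eps / 4) by rewrite /s; field.
rewrite E; lra.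
Qed.

Lemma pack_step z p : fractional z ->
  (forall i, i \in A -> exists2 u, V u & i \in u) ->
  (forall i, 0 <= p i) ->
  (forall u, V u -> \sum_(i in u) p i <= 1) -> 1 + eps <= \sum_i p i * z i ->
  exists2 z', fractional z' & progress z z' (eps ^+ 2 / 32).
Proof.
have [g0 g1] := (gam0, gam1); have [e0 e1] := (eps0, eps1).
move=> [zb zA] AV p0 pu pz; pose s := eps / 8; have s0 : 0 < s by rewrite /s; lra.
(* Membership of [i] in some [u] of [V] bounds [p i], so that a step never makes [z i] negative. *)
have p1 i : i \in A -> p i <= 1.
  move=> /AV[u Vu iu]; apply: le_trans (pu u Vu); rewrite (bigD1 i) //= lerDl.
  exact: sumr_ge0.
pose z' i := z i - s * p i * z i.
have mv i : 0 <= s * p i * z i <= z i.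
  have /andP[x0 _] := zb i; have s1 := ltW s0.
  have -> /= : 0 <= s * p i * z i by rewrite mulr_ge0 // mulr_ge0.
  have [iA|iA] := boolP (i \in A); last by rewrite zA // mulr0.
  by rewrite ler_piMl // mulr_ile1 // ?p1 // /s; lra.
exists z'.
  split=> i; last by move=> iA; rewrite /z' zA // mulr0 subr0.
  by have /andP[x0 x2] := zb i; have /andP[h1 h2] := mv i; rewrite /z'; lra.
move=> u Vu.
have dist : l1dist z' z = s * \sum_i p i * z i.
  rewrite mulr_sumr; apply: eq_bigr => i _; have /andP[h _] := mv i.
  by rewrite /z' addrC addKr normrN ger0_norm // mulrA.
have D : divergence u z' <= divergence u z - s * (\sum_i p i * z i)
     + s * (1 + 2 * s) * \sum_(i in u) p i.
  rewrite /divergence [\sum_(i in u) _]big_mkcond !mulr_sumr -sumrB -big_split /=.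
  apply: ler_sum => i _; have /andP[x0 _] := zb i.
  have [iA|iA] := boolP (i \in A).
    by apply: entropy_pack; rewrite ?p0 ?p1 // /s; lra.
  rewrite /z' zA // !mulr0 !subr0 ifF ?mulr0 ?addr0 //.
  by apply: contraNF iA => /(subsetP (VA Vu)).
have h1 : s * (1 + 2 * s) * (\sum_(i in u) p i) <= s * (1 + 2 * s) * 1.
  by rewrite ler_wpM2l ?pu // mulr_ge0 //; lra.
rewrite dist; set Q := \sum_i p i * z i in D pz *.
(* The movement [s * Q] grows with [Q] as well, so the drop has to beat [eps / 4] of it for all
   [Q >= 1 + eps]. *)
have h2 : 0 <= (Q - 1 - eps) * (1 - eps / 4) by rewrite mulr_ge0; lra.
have h3 : s * (1 + eps / 4 + eps / 4 + eps / 4 * Q) <= s * Q.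
  by rewrite ler_wpM2l ?(ltW s0) //; nra.
have E : eps ^+ 2 / 32 = s * (eps / 4) by rewrite /s; field.
have E2 : s * (1 + 2 * s) = s * (1 + eps / 4) by rewrite /s; field.
rewrite E; rewrite E2 in D h1; lra.
Qed.

Lemma l1dist_triangle z1 z2 z3 : l1dist z1 z3 <= l1dist z1 z2 + l1dist z2 z3.
Proof.
rewrite -big_split; apply: ler_sum => i _ /=.
exact: ler_distD.
Qed.

Lemma progress_trans z1 z2 z3 r1 r2 : progress z1 z2 r1 -> progress z2 z3 r2 ->
  progress z1 z3 (r1 + r2).
Proof.
move=> h1 h2 u Vu; have {h1} h1 := h1 u Vu; have {h2} h2 := h2 u Vu.
have e0 := eps0; have := l1dist_triangle z3 z2 z1.
rewrite -(ler_pM2l (_ : 0 < eps / 4)); last lra.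
by rewrite mulrDr => h3; lra.
Qed.

Definition separable z : Prop :=
  (exists c, [/\ forall i, 0 <= c i <= 2,
     forall u, V u -> 1 <= \sum_(i in u) c i & \sum_i c i * z i <= 1 - eps]) \/
  (exists p, [/\ forall i, 0 <= p i,
     forall u, V u -> \sum_(i in u) p i <= 1 & 1 + eps <= \sum_i p i * z i]).

(** Each violated inequality triggers a step that lowers the divergence of every [u] of [V] by at
    least [eps ^+ 2 / 32]; as divergences are nonnegative, the steps run out. *)
Lemma chase (good : (M -> R) -> Prop) z :
  (exists u, V u) -> (forall i, i \in A -> exists2 u, V u & i \in u) ->
  (forall z, fractional z -> good z \/ separable z) ->
  (forall i, 0 <= z i <= 2) ->
  exists z', [/\ good z', fractional z' & progress z z' 0].
Proof.
have [g0 g1] := (gam0, gam1); have [e0 e1] := (eps0, eps1).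
move=> [u0 Vu0] AV sep zb.
(* Coordinates outside [A], hence outside all [u] of [V], are reset first: each lowers the
   divergence by its full value. *)
pose z0 i := if i \in A then z i else 0.
have fz0 : fractional z0.
  split=> i; rewrite /z0; last by move/negPf->.
  by case: ifP => // _; rewrite lexx; lra.
have pz0 : progress z z0 0.
  move=> u Vu; rewrite addr0 /divergence /l1dist mulr_sumr -big_split /=.
  apply: ler_sum => i _; rewrite /z0; case: (boolP (i \in A)) => iA.
    by rewrite subrr normr0 mulr0 addr0.
  rewrite (negPf (contra (subsetP (VA Vu) i) iA)) /= add0r sub0r normrN.
  have /andP[x0 _] := zb i; rewrite ger0_norm // ler_piMl //; lra.
suff [z' [gz' fz' pz']] : exists z', [/\ good z', fractional z' & progress z0 z' 0].
  by exists z'; split=> //; rewrite -[0]addr0; apply: progress_trans pz'.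
pose r := eps ^+ 2 / 32; have r0 : 0 < r by rewrite divr_gt0 // exprn_gt0.
have [n] : exists n : nat, divergence u0 z0 <= n%:R * r.
  exists (Num.bound (divergence u0 z0 / r)).
  rewrite -ler_pdivrMr // ltW //; apply: archi_boundP.
  by rewrite divr_ge0 ?(ltW r0) // divergence_ge0 // => i; case/andP: (fz0.1 i).
move: fz0; move: {pz0} z0 => z0.
elim: n z0 => [|n IH] z0 fz0 hn.
all: have [gz|sz] := sep _ fz0; first by exists z0; split=> // u Vu;
  rewrite /l1dist big1 ?mulr0 ?addr0 // => i _; rewrite subrr normr0.
all: have [z1 fz1 pz1] : exists2 z', fractional z' & progress z0 z' r
  by case: sz => [[c [h1 h2 h3]]|[p [h1 h2 h3]]];
     [exact: (cover_step fz0 h1 h2 h3)|exact: (pack_step fz0 AV h1 h2 h3)].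
all: have hd : divergence u0 z1 + r <= divergence u0 z0
  by apply: le_trans (pz1 _ Vu0); rewrite lerD2r lerDl mulr_ge0 ?divr_ge0 ?(ltW e0) //;
     apply: sumr_ge0.
  have hd0 : 0 <= divergence u0 z1.
    by apply: divergence_ge0 => // i; case/andP: (fz1.1 i).
  by rewrite mul0r in hn; exfalso; lra.
have [|z' [gz' fz' pz']] := IH z1 fz1.
  by rewrite -natr1 mulrDl mul1r in hn; lra.
exists z'; split=> //.
move=> u Vu; have := progress_trans pz1 pz' Vu; rewrite !addr0 => h; lra.
Qed.

End FractionalChasing.

(** * Competitiveness from a potential *)

Section AmortizedAnalysis.
Context {R : realType} {M : finType}.
Variables (cost : {set M} -> {set M} -> \bar R) (feas allowed : pred {set M}).
Variables (gamma beta rho : R).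
Variables (St : Type) (s0 : St) (out : St -> {set M}) (Inv : St -> Prop).
Variable pot : {set M} -> St -> R.
Implicit Types (u C : {set M}) (st : St).

(** The inequality is asked of every admissible [u] at once, since the offline choice is unknown
    online. *)
Definition amortized_step st C st' : Prop :=
  [/\ Inv st', allowed (out st'), approximate cost feas gamma C (out st') &
    forall u, feas u -> approximate cost feas beta C u ->
      #|symdiff (out st') (out st)|%:R + pot u st' <= pot u st].

(** At each time the offline set moves first, raising the potential by at most [rho] per change;
    then the algorithm moves, paid by the drop of the potential. *)
Lemma competitive_of_potential :
  0 < rho -> Inv s0 -> out s0 = set0 -> pot set0 s0 <= 0 ->
  (forall u st, Inv st -> 0 <= pot u st) ->
  (forall u u' st, Inv st -> pot u st <= pot u' st + rho * #|symdiff u u'|%:R) ->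
  (forall st C, Inv st -> exists st', amortized_step st C st') ->
  competitive cost feas allowed gamma beta rho.
Proof.
move=> rho0 Inv0 out0 pot0 pot_ge0 switch step.
have [next nextP] : {f : St * {set M} -> St &
    forall p, Inv p.1 -> amortized_step p.1 p.2 (f p)}.
  apply: (@choice _ _ (fun p st' => Inv p.1 -> amortized_step p.1 p.2 st')) => -[st C] /=.
  have [i|ni] := pselect (Inv st); last by exists st.
  by have [st' h] := step st C i; exists st'.
pose final h := foldl (fun st C => next (st, C)) s0 h.
exists (fun h => out (final h)) => T c; set A := fun h : seq {set M} => _.
pose sg t := final (take t c).
have sgS t : (t < T)%N -> sg t.+1 = next (sg t, nth set0 c t).
  by move=> tT; rewrite /sg (take_nth set0) ?size_tuple // /final foldl_rcons.
have Isg t : (t <= T)%N -> Inv (sg t).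
  elim: t => [_|t IH tT]; first by rewrite /sg take0.
  by rewrite sgS //; have [] := nextP (sg t, nth set0 c t) (IH (ltnW tT)).
have stepP (t : nat) : (t < T)%N -> amortized_step (sg t) (nth set0 c t) (sg t.+1).
  by move=> tT; rewrite sgS //; exact: (nextP (_, _) (Isg _ (ltnW tT))).
have runE (t : 'I_T) : tnth (run A c) t = out (sg t.+1) by rewrite tnth_mktuple.
have nrun t : (t < T)%N -> nth set0 (run A c) t = out (sg t.+1).
  by move=> tT; rewrite -(tnth_nth _ _ (Ordinal tT)) runE.
split=> [t|].
  by rewrite runE (tnth_nth set0); have [] := stepP t (ltn_ord t).
rewrite /opt_recourse.
have main (s : T.-tuple {set M}) :
    (forall t : 'I_T, feas (tnth s t) && approximate cost feas beta (tnth c t) (tnth s t)) ->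
    (recourse (run A c))%:R <= rho * (recourse s)%:R.
  move=> sP; pose U := nth set0 (set0 :: s).
  pose recm (s : T.-tuple {set M}) m : nat := (\sum_(t < m)
    #|symdiff (nth set0 s t) (nth set0 (set0 :: s) t)|)%N.
  suff h m : (m <= T)%N ->
      (recm (run A c) m)%:R + pot (U m) (sg m) <= rho * (recm s m)%:R.
    have hT := h T (leqnn T); have := pot_ge0 (U T) (sg T) (Isg _ (leqnn T)).
    by rewrite /recm in hT; rewrite /recourse => h0; apply: le_trans hT; rewrite lerDl.
  elim: m => [_|m IH mT].
    by rewrite /recm !big_ord0 mulr0 add0r /sg take0.
  have {IH} IH := IH (ltnW mT).
  have [_ _ _ /(_ (U m.+1))] := stepP m mT.
  have := sP (Ordinal mT); rewrite !(tnth_nth set0) /= => /andP[f1 a1] /(_ f1 a1) h1.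
  have h2 := switch (U m.+1) (U m) (sg m) (Isg _ (ltnW mT)).
  rewrite /recm !big_ord_recr /= !natrD mulrDr nrun //.
  have -> : nth set0 (set0 :: run A c) m = out (sg m).
    case: (m) mT => [|m'] mT' /=; first by rewrite /sg take0.
    by rewrite nrun // ltnW.
  rewrite /recm in IH.
  have -> : nth set0 s m = U m.+1 by [].
  rewrite -/(U m).
  lra.
elim/big_ind : _ => [|x y hx hy|s /forallP sP].
(* Without any valid offline sequence the offline recourse is [+oo], and [rho > 0] keeps the product
   infinite. *)
- by rewrite gt0_muley ?lte_fin // leey.
- by rewrite /mine; case: ifP.
- by rewrite -EFinM lee_fin; exact: main.
Qed.

End AmortizedAnalysis.

(** * Sites and nets *)

Section Sites.
Context {R : realType} {M : finType}.
Variables (d : M -> M -> R) (L : nat).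
Hypothesis dm : is_metric d.

(** Level 0 has radius 0: its balls are single points, so that a zero cost can be matched
    exactly. *)
Definition rad (l : nat) : R := if l is l'.+1 then 2 ^+ l' else 0.

Lemma rad_ge0 l : 0 <= rad l.
Proof. by case: l => //= l; rewrite exprn_ge0. Qed.

Lemma rad_double l l' : (l < l')%N -> 2 * rad l <= rad l'.
Proof.
case: l' => // l'; case: l => [_|l] /=; first by rewrite mulr0 exprn_ge0.
by rewrite !ltnS => h; rewrite -exprS ler_eXn2l // ltr1n.
Qed.

Lemma rad_mono l l' : (l <= l')%N -> rad l <= rad l'.
Proof.
rewrite leq_eqVlt => /predU1P[-> //|/rad_double h]; apply: le_trans h.
by rewrite ler_peMl ?rad_ge0 // ler1n.
Qed.

Definition site : finType := (M * 'I_L.+1)%type.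
Implicit Types (q : site) (N D S : {set site}) (z h : M -> R).

Definition ball q : {set M} := [set p | d q.1 p <= rad q.2].
(** Weaker than sharing a point of [M]: sites that do not meet have disjoint balls, while meeting
    suffices for distance bounds. *)
Definition meets q q' : bool := d q.1 q'.1 <= rad q.2 + rad q'.2.
Definition mass z q : R := \sum_(p in ball q) z p.

Lemma meets_refl q : meets q q.
Proof.
by rewrite /meets (metric_eq0 dm q.1 q.1).2 // addr_ge0 ?rad_ge0.
Qed.

Lemma meets_sym q q' : meets q q' = meets q' q.
Proof. by rewrite /meets addrC (metric_sym dm). Qed.

Lemma ball_meets p q q' : p \in ball q -> p \in ball q' -> meets q q'.
Proof.
rewrite !inE => h h'; apply: le_trans (metric_triangle dm _ p _) _.
by rewrite lerD // (metric_sym dm).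
Qed.

Definition disjoint_family D : bool :=
  [forall q in D, forall q' in D, (q != q') ==> ~~ meets q q'].

Lemma disjoint_familyP D : reflect
  (forall q q', q \in D -> q' \in D -> meets q q' -> q = q') (disjoint_family D).
Proof.
apply: (iffP forall_inP) => [h q q' qD q'D qq'|h q qD].
  apply/eqP; apply: contraTT qq' => nq.
  by move/forall_inP: (h q qD) => /(_ q' q'D) /implyP /(_ nq).
apply/forall_inP => q' q'D; apply/implyP => nq.
by apply: contra nq => /(h _ _ qD q'D) ->.
Qed.

Lemma disjoint_mass D h : disjoint_family D -> (forall p, 0 <= h p) ->
  \sum_(q in D) mass h q <= \sum_p h p.
Proof.
move=> /disjoint_familyP dD h0; rewrite /mass.
under eq_bigr do rewrite big_mkcond /=.
rewrite exchange_big /=; apply: ler_sum => p _; rewrite -big_mkcondr /=.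
have [/existsP[q0 /andP[q0D pq0]]|no] := boolP [exists q, (q \in D) && (p \in ball q)].
  rewrite (bigD1 q0) ?q0D //= big1 ?addr0 // => q /andP[/andP[qD pq]] /eqP[].
  by apply: dD => //; apply: ball_meets pq pq0.
rewrite big1 // => q hq; case/existsP: no; by exists q.
Qed.

Definition separated N : bool :=
  [forall l : 'I_L.+1, disjoint_family [set q in N | q.2 == l]].

Lemma separatedP N : reflect
  (forall q q', q \in N -> q' \in N -> q.2 = q'.2 -> meets q q' -> q = q') (separated N).
Proof.
apply: (iffP forallP) => [h q q' qN q'N e|h l].
  by apply: (disjoint_familyP _ (h q.2)); rewrite inE ?qN ?q'N ?e eqxx.
apply/disjoint_familyP => q q'; rewrite !inE => /andP[qN /eqP el] /andP[q'N /eqP el'].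
by apply: h; rewrite ?el ?el'.
Qed.

(** Balls of one level are disjoint, so each of the [L.+1] levels carries at most the total mass. *)
Lemma separated_mass N h : separated N -> (forall p, 0 <= h p) ->
  \sum_(q in N) mass h q <= L.+1%:R * \sum_p h p.
Proof.
move=> /forallP sN h0; rewrite (partition_big (fun q : site => q.2) predT) //=.
have -> : L.+1%:R * \sum_p h p = \sum_(l < L.+1) \sum_p h p.
  by rewrite sumr_const card_ord mulr_natl.
apply: ler_sum => l _; apply: le_trans (disjoint_mass (sN l) h0).
by rewrite [leRHS](eq_bigl (fun q => (q \in N) && (q.2 == l))) // => q; rewrite inE.
Qed.

Lemma mass_sub z z' q : `|mass z q - mass z' q| <= mass (fun p => `|z p - z' p|) q.
Proof. by rewrite /mass -sumrB ler_norm_sum. Qed.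

(* A birth (mass >= 1/4) lowers the potential by 1 through the term -4 m, which
   accounts for the mass outside the net; a death (mass <= 1/8) lowers it by 1
   through the second term. *)
Definition net_weight (m : R) : R := - (4 * m) + 12 * Num.max 0 (1 / 4 - m).

Definition net_potential N z : R :=
  4 * (L.+1%:R * \sum_p z p) + \sum_(q in N) net_weight (mass z q).

Lemma net_weight_lip m m' : net_weight m <= net_weight m' + 16 * `|m - m'|.
Proof.
rewrite /net_weight; have := ler_norm (m - m'); have := ler_norm (- (m - m')).
rewrite normrN => h1 h2.
have h3 : Num.max 0 (1 / 4 - m) <= Num.max 0 (1 / 4 - m') + `|m - m'|.
  have [a1 a2] : 0 <= Num.max 0 (1 / 4 - m') /\ 1 / 4 - m' <= Num.max 0 (1 / 4 - m').
    by split; rewrite le_max lexx ?orbT.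
  by rewrite ge_max; apply/andP; split; [rewrite addr_ge0|lra].
lra.
Qed.

Lemma net_potential_ge0 N z : separated N -> (forall p, 0 <= z p) ->
  0 <= net_potential N z.
Proof.
move=> sN z0; rewrite /net_potential.
apply: (@le_trans _ _ (4 * (L.+1%:R * (\sum_p z p)) + \sum_(q in N) - (4 * mass z q))).
  by rewrite sumrN -mulr_sumr -mulrBr mulr_ge0 // subr_ge0 separated_mass.
rewrite lerD2l; apply: ler_sum => q _; rewrite lerDl mulr_ge0 //.
by rewrite le_max lexx.
Qed.

Lemma net_potential_lip N z z' : separated N ->
  net_potential N z' <= net_potential N z + 20 * L.+1%:R * l1dist z' z.
Proof.
move=> sN; rewrite /net_potential.
have h1 : L.+1%:R * (\sum_p z' p) <= L.+1%:R * (\sum_p z p) + L.+1%:R * l1dist z' z.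
  rewrite -mulrDr ler_wpM2l // -big_split /=; apply: ler_sum => p _.
  by rewrite -lerBlDl ler_norm.
have h2 : \sum_(q in N) net_weight (mass z' q) <=
    \sum_(q in N) net_weight (mass z q) + 16 * (L.+1%:R * l1dist z' z).
  have := @separated_mass N (fun p => `|z' p - z p|) sN (fun p => normr_ge0 _).
  rewrite -(ler_pM2l (_ : 0 < 16)) // => h; rewrite -lerBlDl; apply: le_trans h.
  rewrite -sumrB mulr_sumr; apply: ler_sum => q _.
  rewrite lerBlDl; apply: le_trans (net_weight_lip _ (mass z q)) _.
  by rewrite lerD2l ler_pM2l // mass_sub.
lra.
Qed.

(** [N'] is a maximal separated family between the surviving sites [K] and [K :|: H]; by maximality
    every heavy site meets a member of its level. The gap between 1/8 and 1/4 lets the potential pay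
    for both births and deaths. *)
Lemma net_step N z z' : separated N -> exists N', [/\ separated N',
  forall q, q \in N' -> 1 / 8 <= mass z' q,
  forall q, 1 / 4 <= mass z' q -> exists q', [/\ q' \in N', q'.2 = q.2 & meets q q'] &
  #|symdiff N' N|%:R + net_potential N' z' <=
    net_potential N z + 20 * L.+1%:R * l1dist z' z].
Proof.
move=> sN; pose K := [set q in N | 1 / 8 <= mass z' q].
pose H := [set q : site | 1 / 4 <= mass z' q].
pose P (X : {set site}) := [&& K \subset X, X \subset K :|: H & separated X].
have PK : P K.
  rewrite /P subxx subsetUl /=; apply/separatedP => q q'.
  by rewrite !inE => /andP[qN _] /andP[q'N _]; exact: (separatedP _ sN).
have [N' /maxsetP[/and3P[KN' N'KH sN'] maxN'] _] := maxset_exists PK.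
exists N'; split=> //.
- by move=> q /(subsetP N'KH); rewrite !inE => /orP[/andP[_ ->]//|]; apply: le_trans; lra.
- move=> q hq; have [/existsP[q' /and3P[q'N /eqP e m]]|no] :=
    boolP [exists q', [&& q' \in N', q'.2 == q.2 & meets q q']]; first by exists q'.
  have no' q' : q' \in N' -> q'.2 = q.2 -> ~~ meets q q'.
    by move=> q'N e; apply: contra no => m; apply/existsP; exists q'; rewrite q'N e eqxx.
  exists q; rewrite meets_refl; split=> //.
  rewrite -(maxN' (q |: N')) ?setU11 ?subsetUr //.
  apply/and3P; split.
  + exact: subset_trans KN' (subsetUr _ _).
  + by rewrite subUset N'KH andbT sub1set !inE hq orbT.
  + apply/separatedP => q1 q2; rewrite !inE => /predU1P[->|q1N] /predU1P[->|q2N] // e m.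
    * by case/negP: (no' q2 q2N (esym e)).
    * by case/negP: (no' q1 q1N e); rewrite meets_sym.
    * exact: (separatedP _ sN').
have KN : K \subset N by apply/subsetP => q; rewrite inE => /andP[].
have c1 : (#|symdiff N' N| <= #|N' :\: K| + #|N :\: K|)%N.
  rewrite card_symdiff leq_add // subset_leq_card //.
    by apply: setDS.
  exact: setDS.
apply: le_trans (net_potential_lip z z' sN).
rewrite /net_potential addrCA lerD2l.
rewrite [X in _ + X <= _](big_setID K) /= (setIidPr KN').
rewrite [leRHS](big_setID K) /= (setIidPr KN).
rewrite addrCA lerD2l.
have h1 : \sum_(q in N' :\: K) net_weight (mass z' q) <= - #|N' :\: K|%:R.
  rewrite -sum1_card natr_sum -sumrN; apply: ler_sum => q; rewrite !inE => /andP[nK qN'].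
  move/subsetP: N'KH => /(_ q qN'); rewrite !inE (negbTE nK) /=.
  move=> hq; rewrite /net_weight max_l; lra.
have h2 : #|N :\: K|%:R <= \sum_(q in N :\: K) net_weight (mass z' q).
  rewrite -sum1_card natr_sum; apply: ler_sum => q; rewrite !inE => /andP[nK qN].
  move: nK; rewrite qN /= -ltNge => hq; rewrite /net_weight max_r; lra.
have := c1; rewrite -(ler_nat R) natrD => c2; lra.
Qed.

(** Vitali selection: sites are taken by increasing level, so a discarded one meets a chosen one
    that is no larger. *)
Lemma greedy_disjoint N : exists D, [/\ D \subset N, disjoint_family D &
  forall q, q \in N -> exists q', [/\ q' \in D, (q'.2 <= q.2)%N & meets q q']].
Proof.
have [n] := ubnP #|N|; elim: n N => // n IH N hn.
have [->|[q0 q0N]] := set_0Vmem N.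
  exists set0; split; rewrite ?subxx //; last by move=> q; rewrite inE.
  by apply/disjoint_familyP => q q'; rewrite inE.
pose q1 := [arg min_(q < q0 in N) (q.2 : nat)].
have [q1N q1min] : q1 \in N /\ forall q, q \in N -> (q1.2 <= q.2)%N.
  by rewrite /q1; case: arg_minnP => // i iN imin; split=> // q; apply: imin.
pose N' := [set q in N | ~~ meets q q1].
have [|D [DN' dD cD]] := IH N'.
  rewrite ltnS in hn; apply: leq_trans hn; apply: proper_card; apply/properP; split.
    by apply/subsetP => q; rewrite inE => /andP[].
  by exists q1 => //; rewrite inE meets_refl andbF.
have DN q : q \in D -> (q \in N) && ~~ meets q q1.
  by move/(subsetP DN'); rewrite inE.
exists (q1 |: D); split.
- rewrite subUset sub1set q1N /=; apply/subsetP => q /DN /andP[] //.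
- apply/disjoint_familyP => a b; rewrite !inE => /predU1P[->|aD] /predU1P[->|bD] // m.
  + by have := DN b bD; rewrite meets_sym m andbF.
  + by have := DN a aD; rewrite m andbF.
  + exact: (disjoint_familyP _ dD).
- move=> q qN; have [m|nm] := boolP (meets q q1).
    by exists q1; rewrite setU11 q1min.
  have [|q' [q'D le m]] := cD q; first by rewrite inE qN.
  by exists q'; rewrite setU1r.
Qed.

(** As a maximum, it drops by at most the number of deleted sites, which makes it a stable benchmark
    for the size of a cover. *)
Definition packing_number N : nat :=
  (\max_(D : {set site} | (D \subset N) && disjoint_family D) #|D|)%N.

Lemma packing_number_ge N D : D \subset N -> disjoint_family D ->
  (#|D| <= packing_number N)%N.
Proof.
by move=> DN dD; rewrite /packing_number (bigop.bigmax_sup D) // DN.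
Qed.

Lemma packing_number_ex N : exists D,
  [/\ D \subset N, disjoint_family D & packing_number N = #|D|].
Proof.
have P0 : (set0 \subset N) && disjoint_family set0.
  by rewrite sub0set; apply/disjoint_familyP => q q'; rewrite inE.
pose A := [pred D : {set site} | (D \subset N) && disjoint_family D].
have A0 : (0 < #|A|)%N by apply/card_gt0P; exists set0.
have [D /andP[DN dD] e] := bigop.eq_bigmax_cond (fun D : {set site} => #|D|) A0.
by exists D.
Qed.

Lemma packing_number_del N N' :
  (packing_number N <= packing_number N' + #|N :\: N'|)%N.
Proof.
have [D [DN dD ->]] := packing_number_ex N.
have h : (#|D :&: N'| <= packing_number N')%N.
  apply: packing_number_ge; first exact: subsetIr.
  apply/disjoint_familyP => q q'; rewrite !inE => /andP[qD _] /andP[q'D _].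
  exact: (disjoint_familyP _ dD).
rewrite -(cardsID N' D) leq_add // subset_leq_card //; exact: setSD.
Qed.

Definition covers S N : Prop := forall q, q \in N ->
  exists q', [/\ q' \in S, (q'.2 <= q.2)%N & meets q q'].

(** Newcomers join [S], and sites that leave the net stay in it, until [S] exceeds three times the
    packing number; then a greedy disjoint family replaces it. Twice the truncated excess of [#|S|]
    over the packing number has by then saved up the price of the rebuild. *)
Lemma cover_update N N' S : covers S N -> exists S',
  [/\ covers S' N', (#|S'| <= 3 * packing_number N')%N, S' \subset S :|: N' &
     (#|symdiff S' S| + 2 * (#|S'| - packing_number N') <=
      2 * (#|S| - packing_number N) + 3 * #|symdiff N' N|)%N].
Proof.
move=> cS; pose S1 := S :|: (N' :\: N).
have b1 : (#|S1| <= #|S| + #|N' :\: N|)%N by apply: leq_card_setU.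
have b2 := packing_number_del N N'.
have [hS|hS] := leqP #|S1| (3 * packing_number N').
  exists S1; split=> //.
  - move=> q qN'; have [qN|qN] := boolP (q \in N).
      by have [q' [q'S le m]] := cS q qN; exists q'; rewrite inE q'S.
    by exists q; rewrite meets_refl !inE qN qN' orbT.
  - by rewrite setUS // subsetDl.
  - have b3 : (#|symdiff S1 S| <= #|N' :\: N|)%N.
      apply: subset_leq_card; apply/subsetP => q; rewrite !inE.
      by case: (q \in S); case: (q \in N); case: (q \in N').
    rewrite (card_symdiff N' N); lia.
have [D [DN dD cD]] := greedy_disjoint N'.
have b3 := packing_number_ge DN dD.
exists D; split=> //; first by lia.
  exact: subset_trans DN (subsetUr _ _).
have b4 : (#|symdiff D S| <= #|D| + #|S|)%N.
  by rewrite card_symdiff leq_add // subset_leq_card // subsetDl.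
rewrite (card_symdiff N' N); lia.
Qed.

End Sites.

(** * Rounding for facility location and k-median *)

Section WeightClasses.
Context {R : realType} {M : finType}.

Lemma sum_rad (n : nat) : \sum_(a < n.+1) rad a <= 2 * rad n :> R.
Proof.
elim: n => [|n IH]; first by rewrite big_ord_recr big_ord0 /= mulr0 addr0.
rewrite big_ord_recr /=; have := @rad_double R n n.+1 (ltnSn n) => /= h; lra.
Qed.

Lemma rad_unbounded (x : R) : exists a, x <= rad a.
Proof.
exists (Num.bound `|x|).+1; apply: le_trans (ler_norm x) _; apply: ltW => /=.
apply: lt_le_trans (archi_boundP (normr_ge0 x)) _.
by rewrite -natrX ler_nat ltnW // ltn_expl.
Qed.

(** [G] doubles from a positive lower bound [t] of the nonzero values of [g] on, and [G 0 = 0] is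
    reserved for [g p = 0]. *)
Lemma weight_classes (g : M -> R) : (forall p, 0 <= g p) ->
  exists (m : nat) (e : M -> 'I_m.+1) (G : nat -> R),
  [/\ forall a, 0 <= G a, forall p, G (e p) <= g p <= 2 * G (e p),
      forall p p', g p <= g p' -> (e p <= e p')%N &
      forall n, \sum_(a < n.+1) G a <= 2 * G n].
Proof.
move=> g0; pose t : R := \big[Num.min/1]_(p | 0 < g p) g p.
have t0 : 0 < t by rewrite /t; elim/big_ind: _ => // x y x0 y0; rewrite lt_min x0.
have tg p : 0 < g p -> t <= g p by move=> gp; rewrite /t (bigD1 p) //= ge_min lexx.
pose G a := t * rad a.
have ex p : exists a, g p <= 2 * G a.
  have [a ha] := rad_unbounded (g p / t); exists a.
  move: ha; rewrite ler_pdivrMr // mulrC -/(G a) => ha.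
  apply: le_trans ha _; rewrite ler_peMl ?ler1n // mulr_ge0 ?rad_ge0 // ltW //.
pose e p := ex_minn (ex p); pose m := (\max_p e p)%N.
have em p : (e p < m.+1)%N by rewrite ltnS /m (@bigop.leq_bigmax _ e p).
exists m, (fun p => Ordinal (em p)), G; split=> [a|p|p p' h|n] /=.
- by rewrite mulr_ge0 ?rad_ge0 // ltW.
- rewrite /e; case: ex_minnP => a ha mina; rewrite ha andbT.
  case: a ha mina => [|[|a]] ha mina; rewrite /G /=.
  + by rewrite mulr0 g0.
  + rewrite expr0 mulr1 tg //; rewrite lt_neqAle g0 andbT eq_sym; apply/eqP => gp0.
    by have := mina 0%N; rewrite gp0 /G mulr0 mulr0 lexx => /(_ isT).
  + rewrite leNgt; apply/negP => h.
    suff : (a.+1 < a.+1)%N by rewrite ltnn.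
    apply: mina; rewrite /G /=; apply: ltW; rewrite exprS in h; lra.
- rewrite /e; case: (ex_minnP (ex p)) => a ha mina; case: (ex_minnP (ex p')) => b hb minb.
  by apply: mina; apply: le_trans h hb.
- rewrite -mulr_sumr mulrCA ler_pM2l //; exact: sum_rad.
Qed.

Lemma sum_imset_le (I : finType) (f : I -> M) (g : M -> R) (A : {set I}) :
  (forall p, 0 <= g p) -> \sum_(s in f @: A) g s <= \sum_(q in A) g (f q).
Proof.
move=> g0; rewrite [leRHS](partition_big f (mem (f @: A))) /=; last first.
  by move=> q qA; apply: imset_f.
apply: ler_sum => s /imsetP[q qA ->]; rewrite (bigD1 q) ?qA ?eqxx //= lerDl.
exact: sumr_ge0.
Qed.

End WeightClasses.

Section FacilityRounding.
Context {R : realType} {M : finType}.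
Variables (d : M -> M -> R) (L : nat) (F : {set M}) (g : M -> R).
Hypothesis dm : is_metric d.
Hypothesis g0 : forall p, 0 <= g p.
Variables (m : nat) (e : M -> 'I_m.+1) (G : nat -> R) (sel : site (M:=M) L -> M).
Hypothesis G0 : forall a, 0 <= G a.
Hypothesis Gg : forall p, G (e p) <= g p <= 2 * G (e p).
Hypothesis e_mono : forall p p', g p <= g p' -> (e p <= e p')%N.
Hypothesis G_sum : forall n, \sum_(a < n.+1) G a <= 2 * G n.
Local Notation site := (site (M:=M) L).
Local Notation ball := (@ball R M d L).
Local Notation mass := (@mass R M d L).
Hypothesis selP : forall q, F :&: ball q != set0 ->
  sel q \in F :&: ball q /\ forall p, p \in F :&: ball q -> g (sel q) <= g p.
Implicit Types (q : site) (N S X : {set site}) (z : M -> R).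

Definition class q : 'I_m.+1 := e (sel q).
Definition section a X : {set site} := [set q in X | class q == a].

Lemma card_section X : (\sum_a #|section a X| = #|X|)%N.
Proof.
rewrite -[RHS]sum1_card (partition_big class predT) //=; apply: eq_bigr => a _.
by rewrite -sum1_card; apply: eq_bigl => q; rewrite inE.
Qed.

Lemma section_symdiff a X Y :
  symdiff (section a X) (section a Y) = section a (symdiff X Y).
Proof.
by apply/setP => q; rewrite !inE; case: (class q == a); rewrite ?andbT ?andbF.
Qed.

(** [S] may keep sites that left [N]; that their balls contain a facility is therefore recorded
    separately. *)
Definition rounding_inv N S : Prop :=
  [/\ separated d N, forall a, covers d (section a S) (section a N) &
      forall q, q \in S -> F :&: ball q != set0].

(** The factor 3 is the price of a net change in [cover_update]; the second term sums its truncated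
    excesses over the classes. *)
Definition rounding_potential N S z : R := 3 * net_potential d N z +
  (\sum_a 2 * (#|section a S| - packing_number d (section a N)))%N%:R.

Lemma mass_reaches_F z q : (forall p, p \notin F -> z p = 0) -> 0 < mass z q ->
  F :&: ball q != set0.
Proof.
move=> zF; apply: contraTneq => h; rewrite [mass z q]big1 ?ltxx // => p pb.
by apply: zF; apply/negP => pF; have : p \in F :&: ball q by [rewrite inE pF];
  rewrite h inE.
Qed.

(* A point p lies in at most one ball of each disjoint subfamily, and only in
   balls of classes at most e p: their weights form a geometric series. *)
Lemma opening_cost N S z : (forall p, 0 <= z p) ->
  (forall p, p \notin F -> z p = 0) -> (forall q, q \in N -> 1 / 8 <= mass z q) ->
  (forall a, #|section a S| <= 3 * packing_number d (section a N))%N ->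
  \sum_(s in sel @: S) g s <= 96 * \sum_p g p * z p.
Proof.
move=> z0 zF Nm Sc; apply: le_trans (sum_imset_le sel S g0) _.
rewrite (partition_big class predT) //=.
(* 48 = 2 * 3 * 8, from the width of a class, the size of a section against its packing number, and
   masses of at least 1/8. The geometric sum over classes doubles it. *)
apply: (@le_trans _ _ (\sum_(a < m.+1) 48 * (G a * \sum_(p | (a <= e p)%N) z p))).
  apply: ler_sum => a _.
  have [D [DN dD eD]] := packing_number_ex d (section a N).
  have h1 : \sum_(q in S | class q == a) g (sel q) <= 2 * G a * #|section a S|%:R.
    rewrite mulr_natr -sumr_const [leRHS](eq_bigl (fun q => (q \in S) && (class q == a))).
      by apply: ler_sum => q /andP[_ /eqP <-]; case/andP: (Gg (sel q)).
    by move=> q; rewrite inE.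
  apply: le_trans h1 _.
  have h2 : #|section a S|%:R <= 3 * #|D|%:R :> R by rewrite -natrM ler_nat -eD.
  have h3 : #|D|%:R <= 8 * \sum_(p | (a <= e p)%N) z p.
    rewrite big_mkcond; set h := fun p => if (a <= e p)%N then z p else 0.
    have hh : forall p, 0 <= h p by move=> p; rewrite /h; case: ifP.
    have := disjoint_mass dm dD hh; rewrite -(ler_pM2l (_ : 0 < 8)) //.
    apply: le_trans; rewrite -sum1_card natr_sum mulr_sumr; apply: ler_sum => q qD.
    have /(subsetP DN) := qD; rewrite inE => /andP[qN /eqP ca].
    suff -> : mass h q = mass z q by have := Nm q qN => ?; lra.
    apply: eq_bigr => p pb; rewrite /h; case: ifP => // ae.
    rewrite zF //; apply: contraFN ae => pF; rewrite -ca /class; apply: e_mono.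
    have pFb : p \in F :&: ball q by rewrite inE pF.
    have [|_] := @selP q; last exact.
    by apply/set0Pn; exists p.
  have h4 := G0 a.
  have h5 : G a * #|section a S|%:R <= G a * (3 * (8 * \sum_(p | (a <= e p)%N) z p)).
    by rewrite ler_wpM2l //; lra.
  lra.
rewrite -mulr_sumr; have -> : 96 = 48 * 2 :> R by lra.
rewrite -mulrA ler_pM2l // mulr_sumr.
under eq_bigr do rewrite mulr_sumr.
rewrite (exchange_big_dep predT) //=; apply: ler_sum => p _.
rewrite -mulr_suml mulrA ler_wpM2r //.
have -> : \sum_(i < m.+1 | (i <= e p)%N) G i = \sum_(i < (e p).+1) G i.
  rewrite (big_ord_widen m.+1 G) //; apply: eq_bigl => i; by rewrite ltnS.
apply: le_trans (G_sum _) _; rewrite ler_pM2l //; by case/andP: (Gg p).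
Qed.

Lemma round_step N S z z' : rounding_inv N S -> (forall p, 0 <= z' p) ->
  (forall p, p \notin F -> z' p = 0) ->
  exists N' S', [/\ rounding_inv N' S', sel @: S' \subset F,
    \sum_(s in sel @: S') g s <= 96 * \sum_p g p * z' p,
    forall j l, 1 / 4 <= mass z' (j, l) ->
      exists2 s, s \in sel @: S' & d s j <= 5 * rad l &
    #|symdiff (sel @: S') (sel @: S)|%:R + rounding_potential N' S' z' <=
      rounding_potential N S z + 60 * L.+1%:R * l1dist z' z].
Proof.
move=> [sN cSN SF] z0 zF.
have [N' [sN' N'8 N'4 N'pot]] := net_step dm z z' sN.
have [f fP] := choice (fun a => cover_update dm (section a N') (cSN a)).
pose S' := [set q | q \in f (class q)].
have fsec a : section a S' = f a.
  apply/setP => q; rewrite !inE; apply/andP/idP => [[h /eqP <-] //|qf].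
  have [_ _ sub _] := fP a; have := subsetP sub q qf; rewrite !inE.
  have [->|/=] := eqVneq (class q) a; first by rewrite qf.
  by rewrite !andbF.
have S'F q : q \in S' -> F :&: ball q != set0.
  rewrite inE => qf; have [_ _ sub _] := fP (class q).
  have := subsetP sub q qf; rewrite !inE eqxx !andbT => /orP[/SF //|/N'8 h].
  by apply: (mass_reaches_F zF); lra.
have sc a : (#|section a S'| <= 3 * packing_number d (section a N'))%N.
  by rewrite fsec; have [] := fP a.
exists N', S'; split.
- by split=> // a; rewrite fsec; have [] := fP a.
- apply/subsetP => s /imsetP[q qS ->]; have [+ _] := selP (S'F q qS).
  by rewrite inE => /andP[].
- exact: (opening_cost z0 zF N'8 sc).
(* [sel q2] lies in the ball of [q2], which meets [q1], which meets [(j, l)]; no radius exceeds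
   [rad l], hence 5 = 1 + 2 + 2. *)
- move=> j l hm; have [q1 [q1N l1 m1]] := N'4 (j, l) hm.
  have : q1 \in section (class q1) N' by rewrite inE q1N eqxx.
  have [cv _ _ _] := fP (class q1); move/cv => [q2 [+ l2 m2]].
  rewrite -fsec inE => /andP[q2S _]; exists (sel q2); first exact: imset_f.
  have [+ _] := selP (S'F q2 q2S); rewrite inE => /andP[_].
  rewrite inE => h2; move: m1 m2 h2; rewrite /meets l1 /=.
  have h3 : rad q2.2 <= rad l :> R by apply: rad_mono; rewrite l1 in l2.
  have t1 := metric_triangle dm (sel q2) q2.1 j; have t2 := metric_triangle dm q2.1 q1.1 j.
  rewrite (metric_sym dm (sel q2) q2.1) (metric_sym dm q2.1 q1.1) in t1 t2.
  by rewrite (metric_sym dm q1.1 j) in t2 => *; lra.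
have b1 := card_symdiff_imset sel S' S.
have b2 : (#|symdiff S' S| + \sum_a 2 * (#|section a S'| - packing_number d (section a N')) <=
    \sum_a 2 * (#|section a S| - packing_number d (section a N)) + 3 * #|symdiff N' N|)%N.
  rewrite -(card_section (symdiff S' S)) -(card_section (symdiff N' N)) big_distrr /=.
  rewrite -!big_split /=; apply: leq_sum => a _; rewrite -!section_symdiff fsec.
  by have [] := fP a.
have b3 : #|symdiff (sel @: S') (sel @: S)|%:R +
    (\sum_a 2 * (#|section a S'| - packing_number d (section a N')))%N%:R <=
    (\sum_a 2 * (#|section a S| - packing_number d (section a N)))%N%:R +
    3 * #|symdiff N' N|%:R :> R.
  by rewrite -natrM -!natrD ler_nat; apply: leq_trans b2; rewrite leq_add2r.
rewrite /rounding_potential; lra.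
Qed.

Lemma rounding_potential_ge0 N S z : separated d N -> (forall p, 0 <= z p) ->
  0 <= rounding_potential N S z.
Proof. by move=> sN z0; rewrite addr_ge0 // mulr_ge0 // net_potential_ge0. Qed.

End FacilityRounding.

(** * Connection costs, level by level *)

Section ConnectionCost.
Context {R : realType} {M : finType}.
Variables (d : M -> M -> R) (L : nat).
Hypothesis dm : is_metric d.
Hypothesis dmin : forall i j, i != j -> 1 <= d i j.
Hypothesis dmax : forall i j, d i j <= rad L.
Local Notation site := (site (M:=M) L).
Local Notation ball := (@ball R M d L).
Local Notation mass := (@mass R M d L).
Implicit Types (C S u : {set M}) (z : M -> R) (q : site).

Lemma connection_cost_le S s j : s \in S -> (connection_cost d S j <= (d s j)%:E)%E.
Proof. by move=> sS; rewrite /connection_cost (bigD1 s) //= ge_min lexx. Qed.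

Lemma connection_cost_attained S j : S != set0 ->
  exists2 s, s \in S & connection_cost d S j = (d s j)%:E.
Proof.
move=> /set0Pn[s0 s0S].
suff : connection_cost d S j = +oo%E \/
    exists2 s, s \in S & connection_cost d S j = (d s j)%:E.
  by case=> // h; have := connection_cost_le j s0S; rewrite h.
rewrite /connection_cost; elim/big_ind: _ => [|x y hx hy|s sS]; first by left.
  by rewrite /mine; case: ifP.
by right; exists s.
Qed.

Lemma connection_cost_ge0 S j : (0 <= connection_cost d S j)%E.
Proof.
rewrite /connection_cost; elim/big_ind: _ => [|x y hx hy|s sS]; first exact: leey.
  by rewrite le_min hx.
by rewrite lee_fin (metric_ge0 dm).
Qed.

Lemma kmedian_cost_ge0 C S : (0 <= kmedian_cost d C S)%E.
Proof. by apply: sume_ge0 => j _; apply: connection_cost_ge0. Qed.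

Lemma kmedian_cost_fin C S (B : R) j : j \in C ->
  (kmedian_cost d C S <= B%:E)%E -> S != set0.
Proof.
move=> jC; apply: contraTneq => ->; rewrite /kmedian_cost (bigD1 j) //=.
rewrite {1}/connection_cost big_set0 addye ?leye_eq //.
rewrite gt_eqF // (lt_le_trans ltNy0) // sume_ge0 // => i _.
exact: connection_cost_ge0.
Qed.

(** The sum is geometric, dominated by the last radius below [x]. Values strictly between 0 and 1
    are excluded because level 0 alone contributes 1. The bound by [2 * rad n] serves the
    induction. *)
Lemma missed_levels_bound (x : R) n : x = 0 \/ 1 <= x ->
  \sum_(l < n) (if rad l < x then rad l.+1 else 0) <= 4 * x.
Proof.
move=> hx; have x0 : 0 <= x by case: hx => [->//|]; apply: le_trans.
suff h : (\sum_(l < n) (if rad l < x then rad l.+1 else 0) <= 4 * x) /\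
  (\sum_(l < n) (if rad l < x then rad l.+1 else 0) <= 2 * rad n :> R) by case: h.
elim: n => [|n [IH1 IH2]]; first by rewrite big_ord0 mulr0 mulr_ge0.
have h1 := @rad_double R n n.+1 (ltnSn n); have h2 := rad_ge0 (R:=R) n.
rewrite big_ord_recr /= -[2 ^+ n]/(rad n.+1).
case: ltP => hn; last by rewrite addr0; split=> //; lra.
have h3 : rad n.+1 <= 2 * x.
  case: n hn {IH1 IH2 h1 h2} => [|n] hn /=; last by rewrite exprS /= in hn *; lra.
  by case: hx => hx; rewrite ?hx ?ltxx in hn * => //; lra.
by split; lra.
Qed.

(** A client at distance [x] from [u] misses exactly the levels of radius below [x], so over all its
    levels these values sum to at most [4 * x]. *)
Definition missed u q : R := if u :&: ball q == set0 then rad q.2.+1 else 0.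

Lemma missed_cost C u (B : R) : (kmedian_cost d C u <= B%:E)%E ->
  \sum_(q : site | q.1 \in C) missed u q <= 4 * B.
Proof.
move=> hB.
have [->|[j0 j0C]] := set_0Vmem C.
  rewrite big_pred0; last by move=> q; rewrite inE.
  by rewrite mulr_ge0 //; have := le_trans (kmedian_cost_ge0 _ _) hB; rewrite lee_fin.
have u0 := kmedian_cost_fin j0C hB.
have [f fP] := choice (fun j => let: ex_intro2 s a b :=
   connection_cost_attained j u0 in ex_intro
   (fun s => s \in u /\ connection_cost d u j = (d s j)%:E) s (conj a b)).
have hf : \sum_(j in C) d (f j) j <= B.
  move: hB; rewrite /kmedian_cost (eq_bigr (fun j => (d (f j) j)%:E)).
    by rewrite sumEFin lee_fin.
  by move=> j _; case: (fP j).
apply: (@le_trans _ _ (\sum_(j in C) 4 * d (f j) j)); last by rewrite -mulr_sumr ler_pM2l.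
have -> : \sum_(q : site | q.1 \in C) missed u q =
    \sum_(j in C) \sum_(l < L.+1) missed u (j, l).
  by rewrite pair_big /=; apply: eq_big => [[j l]|[j l] _] //=; rewrite andbT.
apply: ler_sum => j _.
have [fu _] := fP j.
have hx : d (f j) j = 0 \/ 1 <= d (f j) j.
  have [->|/dmin] := eqVneq (f j) j; [left|by right].
  exact/(metric_eq0 dm).
apply: le_trans (missed_levels_bound L.+1 hx); apply: ler_sum => l _.
rewrite /missed; case: eqP => [e0|_]; last by case: ifP => // _; rewrite rad_ge0.
case: ltP => // h; exfalso.
have : f j \in u :&: ball (j, l) by rewrite !inE fu (metric_sym dm).
by rewrite e0 inE.
Qed.

(** Fractional counterpart of the sum of [missed], with mass 1/4 as the threshold for being hit. *)
Definition light_cost z C : R :=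
  \sum_(q : site | (q.1 \in C) && (mass z q < 1 / 4)) rad q.2.+1.

(** The separating [c] counts the light balls containing a point, weighted by the next radius. Each
    [u] of [V] misses weight at most [4 * B] of the total [W], while [z] collects at most [W / 4];
    division by [k = W - 4 * B > W / 2] gives the gap. *)
Lemma light_cost_separable (V : pred {set M}) C (B : R) z :
  (forall p, 0 <= z p) -> 0 <= B ->
  (forall u, V u -> (kmedian_cost d C u <= B%:E)%E) -> 8 * B < light_cost z C ->
  exists c, [/\ forall i, 0 <= c i <= 2,
     forall u, V u -> 1 <= \sum_(i in u) c i & \sum_i c i * z i <= 1 - 1 / 2].
Proof.
move=> z0 B0 VB hW; set W := light_cost z C in hW.
pose P q := (q.1 \in C) && (mass z q < 1 / 4).
pose k := W - 4 * B; have k0 : 0 < k by rewrite /k; lra.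
pose c i := (\sum_(q | P q) if i \in ball q then rad q.2.+1 else 0) / k.
exists c; split.
- move=> i; rewrite divr_ge0 ?(ltW k0) //=; last first.
    by apply: sumr_ge0 => q _; case: ifP => // _; apply: rad_ge0.
  rewrite ler_pdivrMr //; apply: (@le_trans _ _ W); last by rewrite /k; lra.
  by apply: ler_sum => q _; case: ifP => // _; apply: rad_ge0.
- move=> u Vu; rewrite -mulr_suml ler_pdivlMr // mul1r exchange_big /=.
  rewrite /k lerBlDr -/W; have h := missed_cost (VB u Vu).
  apply: le_trans (lerD (lexx _) h).
  rewrite [\sum_(q : site | q.1 \in C) _](bigID (fun q => mass z q < 1 / 4)) /= addrA.
  rewrite -[W]addr0; apply: lerD; last first.
    by apply: sumr_ge0 => q _; rewrite /missed; case: ifP => // _; apply: rad_ge0.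
  rewrite -big_split /=; apply: ler_sum => q _; rewrite /missed; case: ifPn => e0.
    rewrite lerDr; apply: sumr_ge0 => i _; case: ifP => // _; exact: rad_ge0.
  case/set0Pn: e0 => i; rewrite inE => /andP[iu ib].
  rewrite addr0 (bigD1 i) //= ib lerDl; apply: sumr_ge0 => i' _; case: ifP => // _.
- have -> : \sum_i c i * z i = (\sum_(q | P q) rad q.2.+1 * mass z q) / k.
    rewrite /c; under eq_bigr do rewrite mulrAC mulr_suml.
    rewrite -mulr_suml; congr (_ / _).
    rewrite exchange_big /=; apply: eq_bigr => q _; rewrite mulr_sumr [RHS]big_mkcond /=.
    by apply: eq_bigr => i _; case: ifP; rewrite ?mul0r.
  rewrite ler_pdivrMr //; apply: (@le_trans _ _ (\sum_(q | P q) rad q.2.+1 * (1 / 4))).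
    by apply: ler_sum => q /andP[_ h]; rewrite ler_wpM2l ?rad_ge0 // ltW.
  by rewrite -mulr_suml -[\sum_(q | P q) _]/W /k; lra.
Qed.

(** If the lowest heavy level [l] of [j] is positive, level [l - 1] is light and contributes
    [rad l]. Heaviness of the top level ensures that [l] exists. *)
Lemma heavy_cover_cost C z S : (forall j, j \in C -> 1 / 4 <= mass z (j, ord_max)) ->
  (forall j l, 1 / 4 <= mass z (j, l) -> exists2 s, s \in S & d s j <= 5 * rad l) ->
  (kmedian_cost d C S <= (5 * light_cost z C)%:E)%E.
Proof.
move=> htop hS.
have -> : light_cost z C = \sum_(j in C) \sum_(l < L.+1)
    if mass z (j, l) < 1 / 4 then rad l.+1 else 0.
  rewrite /light_cost big_mkcondr pair_big /=.
  by apply: eq_big => [[j l]|[j l] _] //=; rewrite andbT.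
rewrite mulr_sumr -sumEFin; apply: lee_sum => j jC.
pose l := [arg min_(l < (ord_max : 'I_L.+1) | 1 / 4 <= mass z (j, l)) (l : nat)].
have [hl minl] : 1 / 4 <= mass z (j, l) /\
    forall l', 1 / 4 <= mass z (j, l') -> (l <= l')%N.
  by rewrite /l; case: arg_minnP => //; exact: htop.
have [s sS hs] := hS j l hl.
apply: le_trans (connection_cost_le j sS) _; rewrite lee_fin; apply: le_trans hs _.
rewrite ler_pM2l //; case: (posnP l) => [->|l0].
  by apply: sumr_ge0 => i _; case: ifP => // _; rewrite exprn_ge0.
have hl' : (l.-1 < L.+1)%N by rewrite (leq_ltn_trans (leq_pred _)).
rewrite (bigD1 (Ordinal hl')) //= ifT; last first.
  by rewrite ltNge; apply/negP => /minl /=; rewrite leqNgt ltn_predL l0.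
rewrite -[2 ^+ l.-1]/(rad l.-1.+1) prednK // lerDl.
by apply: sumr_ge0 => i _; case: ifP => // _; rewrite exprn_ge0.
Qed.

Lemma mass_top z j : mass z (j, ord_max) = \sum_p z p.
Proof. by apply: eq_bigl => p; rewrite inE /= dmax. Qed.

End ConnectionCost.

(** * The algorithm for sums of connection costs *)

Section SumCostAlgorithm.
Context {R : realType} {M : finType}.
Variables (d : M -> M -> R) (L : nat) (F : {set M}) (g : M -> R) (gam : R).
Hypothesis dm : is_metric d.
Hypothesis dmin : forall i j, i != j -> 1 <= d i j.
Hypothesis dmax : forall i j, d i j <= rad L.
Hypothesis g0 : forall p, 0 <= g p.
Hypotheses (gam0 : 0 < gam) (gam1 : gam <= 1) (gamF : 16 * gam * #|F|%:R <= 1).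
Implicit Types (C S u : {set M}) (V : pred {set M}) (z : M -> R).

(** Quantifying over all common bounds [G] and [B] avoids maxima over [V]. Fractional loss times
    rounding loss gives 144 = 3/2 * 96 and 40 = 8 * 5. *)
Definition within_budget V C S : Prop :=
  [/\ S \subset F,
      forall G, (forall u, V u -> \sum_(i in u) g i <= G) ->
        \sum_(i in S) g i <= 144 * G &
      forall B, (forall u, V u -> (kmedian_cost d C u <= B%:E)%E) ->
        (kmedian_cost d C S <= (40 * B)%:E)%E].

Definition fractional_budget V C z : Prop :=
  [/\ forall G, (forall u, V u -> \sum_(i in u) g i <= G) ->
        \sum_i g i * z i <= 3 / 2 * G,
      forall B, (forall u, V u -> (kmedian_cost d C u <= B%:E)%E) ->
        light_cost d L z C <= 8 * B &
      (forall u, V u -> u != set0) -> 1 / 4 <= \sum_p z p].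

Lemma fractional_step V C z : (exists u, V u) -> (forall u, V u -> u \subset F) ->
  (forall i, 0 <= z i <= 2) ->
  exists z', [/\ fractional_budget V C z', forall i, 0 <= z' i <= 2,
    forall i, i \notin F -> z' i = 0 &
    forall u, V u -> divergence gam u z' + 1 / 8 * l1dist z' z <= divergence gam u z].
Proof.
move=> Vn VF zb; pose A := [set i | [exists u, V u && (i \in u)]].
have AV i : i \in A -> exists2 u, V u & i \in u.
  by rewrite inE => /existsP[u /andP[Vu iu]]; exists u.
have VA u : V u -> u \subset A.
  by move=> Vu; apply/subsetP => i iu; rewrite inE; apply/existsP; exists u; rewrite Vu.
have AF : A \subset F by apply/subsetP => i /AV[u /VF /subsetP]; apply.
have [h0 h1] : 0 < 1 / 2 :> R /\ 1 / 2 <= 1 :> R by split; lra.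
have gA : 8 * gam * #|A|%:R <= 1 / 2.
  have : gam * #|A|%:R <= gam * #|F|%:R.
    by rewrite ler_wpM2l ?(ltW gam0) // ler_nat subset_leq_card.
  by have gF := gamF => h; lra.
have [|z' [gz' [zb' zA] pz']] := @chase _ _ gam gam0 gam1 (1 / 2) A V h0 h1 gA VA
    (fractional_budget V C) z Vn AV _ zb; last first.
  exists z'; split=> // [i iF|u Vu]; first by apply: zA; apply: contra iF; exact: (subsetP AF).
  by have := pz' u Vu; rewrite addr0 => h; lra.
move=> {zb}z [zb zA].
have z0 i : 0 <= z i by case/andP: (zb i).
have [|ns] := pselect (separable (1 / 2) V z); first by right.
left; have [u0 Vu0] := Vn; split=> [G hG|B hB|nV].
- have G0 : 0 <= G by apply: le_trans (hG u0 Vu0); apply: sumr_ge0.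
  rewrite leNgt; apply/negP => hgz.
  (* The packing inequality is normalized by [G]. If [G = 0], then [g] vanishes on [A], each point
     of which lies in some [u] of [V]. *)
  have [Gz|Gp] := eqVneq G 0.
    move: hgz; rewrite Gz mulr0 big1 ?ltxx // => i _.
    have [/AV[u Vu iu]|/zA ->] := boolP (i \in A); last by rewrite mulr0.
    have := hG u Vu; rewrite Gz (bigD1 i) //= => h.
    have h2 : 0 <= \sum_(j in u | j != i) g j by apply: sumr_ge0.
    have -> : g i = 0 by have := g0 i => h3; lra.
    by rewrite mul0r.
  have Gpos : 0 < G by rewrite lt_neqAle eq_sym Gp.
  apply: ns; right; exists (fun i => g i / G); split.
  + by move=> i; rewrite divr_ge0.
  + by move=> u Vu; rewrite -mulr_suml ler_pdivrMr // mul1r hG.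
  + under eq_bigr do rewrite mulrAC.
    rewrite -mulr_suml ler_pdivlMr //; lra.
- rewrite leNgt; apply/negP => hW; apply: ns; left.
  apply: (light_cost_separable dm dmin z0 _ hB hW).
  by have := le_trans (kmedian_cost_ge0 dm _ _) (hB u0 Vu0); rewrite lee_fin.
- rewrite leNgt; apply/negP => hz; apply: ns; left; exists (fun=> 1); split.
  + by move=> i; rewrite ler01 ler1n.
  + by move=> u /nV; rewrite -card_gt0 sumr_const ler1n.
  + by under eq_bigr do rewrite mul1r; lra.
Qed.

Variables (m : nat) (e : M -> 'I_m.+1) (Gc : nat -> R) (sel : site (M:=M) L -> M).
Hypothesis Gc0 : forall a, 0 <= Gc a.
Hypothesis Gg : forall p, Gc (e p) <= g p <= 2 * Gc (e p).
Hypothesis e_mono : forall p p', g p <= g p' -> (e p <= e p')%N.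
Hypothesis G_sum : forall n, \sum_(a < n.+1) Gc a <= 2 * Gc n.
Hypothesis selP : forall q, F :&: ball d q != set0 ->
  sel q \in F :&: ball d q /\ forall p, p \in F :&: ball d q -> g (sel q) <= g p.

Definition alg_state : Type := ((M -> R) * ({set site (M:=M) L} * {set site (M:=M) L}))%type.
Implicit Type st : alg_state.
Definition alg_out st : {set M} := sel @: st.2.2.
Definition alg_inv st : Prop :=
  (forall i, 0 <= st.1 i <= 2) /\ rounding_inv d F e sel st.2.1 st.2.2.
(** 480 = 60 * 8: rounding costs [60 * L.+1%:R] per unit of movement, and the divergence drops by
    1/8 per unit. *)
Definition alg_potential u st : R :=
  480 * L.+1%:R * divergence gam u st.1 + rounding_potential d e sel st.2.1 st.2.2 st.1.

Lemma sum_cost_step V C st : (exists u, V u) -> (forall u, V u -> u \subset F) ->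
  alg_inv st -> exists st', [/\ alg_inv st', within_budget V C (alg_out st') &
    forall u, V u -> #|symdiff (alg_out st') (alg_out st)|%:R + alg_potential u st' <=
      alg_potential u st].
Proof.
move=> Vn VF; case: st => z [N S] [/= zb NS].
have [z' [[b1 b2 b3] zb' zF pz]] := fractional_step C Vn VF zb.
have z0 i : 0 <= z' i by case/andP: (zb' i).
have [N' [S' [inv' SF c1 c2 pot]]] :=
  round_step dm g0 Gc0 Gg e_mono G_sum selP z NS z0 zF.
exists (z', (N', S')); split=> //.
  split=> // [G hG|B hB]; first by have := b1 G hG => ?; rewrite /alg_out /=; lra.
  apply: le_trans (heavy_cover_cost _ c2) _; last first.
    by rewrite lee_fin; have := b2 B hB => ?; lra.
  move=> j jC; rewrite (mass_top dmax); apply: b3 => u Vu.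
  exact: (kmedian_cost_fin dm jC (hB u Vu)).
move=> u Vu; rewrite /alg_out /alg_potential /=.
have h1 := pz u Vu.
have h2 : 480 * L.+1%:R * (divergence gam u z' + 1 / 8 * l1dist z' z) <=
    480 * L.+1%:R * divergence gam u z by rewrite ler_wpM2l // mulr_ge0 ?ler0n.
rewrite mulrDr in h2.
lra.
Qed.

End SumCostAlgorithm.

Lemma sum_cost_competitive (R : realType) (M : finType) (d : M -> M -> R) (L : nat)
    (F : {set M}) (g : M -> R) (gam : R) (cost : {set M} -> {set M} -> \bar R)
    (feas allowed : pred {set M}) (gamma beta rho : R) :
  is_metric d -> (forall i j, i != j -> 1 <= d i j) -> (forall i j, d i j <= rad L) ->
  (forall p, 0 <= g p) -> 0 < gam -> gam <= 1 -> 16 * gam * #|F|%:R <= 1 ->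
  0 < rho -> 480 * L.+1%:R * (3 - ln gam) <= rho ->
  (forall C, exists u, feas u && approximate cost feas beta C u) ->
  (forall u, feas u -> u \subset F) ->
  (forall C S, within_budget d F g
      (fun u => feas u && approximate cost feas beta C u) C S ->
    allowed S /\ approximate cost feas gamma C S) ->
  competitive cost feas allowed gamma beta rho.
Proof.
move=> dm dmin dmax g0 gam0 gam1 gamF rho0 hrho Vn VF good.
have [m [e [G [G0 Gg e_mono G_sum]]]] := weight_classes g0.
have [sel selP] : {sel : site (M:=M) L -> M & forall q, F :&: ball d q != set0 ->
    sel q \in F :&: ball d q /\ forall p, p \in F :&: ball d q -> g (sel q) <= g p}.
  apply: (@choice _ _ (fun q s => F :&: ball d q != set0 -> s \in F :&: ball d q /\
    forall p, p \in F :&: ball d q -> g s <= g p)) => q.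
  have [->|/set0Pn[p0 hp0]] := eqVneq (F :&: ball d q) set0; first by exists q.1.
  by case: (arg_minP g hp0) => p hp minp; exists p.
apply: (@competitive_of_potential _ _ cost feas allowed gamma beta rho _
  ((fun=> 0), (set0, set0)) (alg_out sel) (alg_inv d F e sel)
  (alg_potential d gam e sel)) => //.
- split=> /= [i|]; first by rewrite lexx ler0n.
  split=> [|a|q]; rewrite ?inE //; last by move=> q; rewrite !inE.
  by apply/separatedP => q q'; rewrite inE.
- by rewrite /alg_out imset0.
- rewrite /alg_potential /divergence big1 ?mulr0 ?add0r; last first.
    by move=> i _; rewrite inE.
  rewrite /rounding_potential /net_potential big1 // !big_set0 !mulr0 add0r mulr0 add0r.
  rewrite big1 // => a _; rewrite [section _ _ _ _](_ : _ = set0) ?cards0 ?sub0n ?muln0 //.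
  by apply/setP => q; rewrite !inE.
- move=> u st [zb [sN _ _]]; have z0 i : 0 <= st.1 i by case/andP: (zb i).
  by apply: addr_ge0; [rewrite !mulr_ge0 ?ler0n ?divergence_ge0|exact: rounding_potential_ge0].
- move=> u u' st [zb _]; rewrite /alg_potential addrAC lerD2r.
  have c0 : 0 <= 480 * L.+1%:R :> R by rewrite mulr_ge0 ?ler0n.
  have h := ler_wpM2l c0 (divergence_switch gam0 gam1 u u' zb).
  have h2 : 480 * L.+1%:R * (3 - ln gam) * #|symdiff u u'|%:R <= rho * #|symdiff u u'|%:R.
    by rewrite ler_wpM2r.
  by rewrite mulrDr mulrA in h; lra.
- move=> st C hst.
  have [st' [inv' bud pot']] := sum_cost_step dm dmin dmax g0 gam0 gam1 gamF
     G0 Gg e_mono G_sum selP C (Vn C) (fun u Vu => VF u (andP Vu).1) hst.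
  have [ok1 ok2] := good C _ bud.
  by exists st'; split=> // u fu au; apply: pot'; rewrite fu.
Qed.

(** * Rounding for k-center *)

Section CenterRounding.
Context {R : realType} {M : finType}.
Variables (d : M -> M -> R) (L k : nat) (eps : R).
Hypothesis dm : is_metric d.
Hypotheses (eps0 : 0 < eps) (eps1 : eps <= 1 / 2).
Local Notation site := (site (M:=M) L).
Local Notation ball := (@ball R M d L).
Local Notation mass := (@mass R M d L).
Implicit Types (q n : site) (N S D : {set site}) (z : M -> R) (mov : R).

(* [N] collects the sites added since the last reset, even if evicted, and [mov] is
   the fractional movement since then. *)
Definition epoch_inv N S z mov : Prop :=
  [/\ separated d N, (S \subset N) && disjoint_family d S,
      forall n, n \in N -> exists2 q, q \in S & d n.1 q.1 + 3 * rad q.2 <= 3 * rad n.2 &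
      forall D, D \subset N -> disjoint_family d D ->
        (1 - eps) * #|D|%:R <= \sum_(q in D) mass z q + mov].

Definition saturated N z : Prop := forall q, 1 - eps <= mass z q ->
  exists n, [/\ n \in N, n.2 = q.2 & meets d q n].

Lemma disjoint_familyS D D' : D \subset D' -> disjoint_family d D' -> disjoint_family d D.
Proof.
move=> /subsetP DD' /disjoint_familyP h; apply/disjoint_familyP => q q' qD q'D.
by apply: h; apply: DD'.
Qed.

(** [q] brings mass at least [1 - eps], enough for one more member of [D]. *)
Lemma epoch_packing N z mov q : 1 - eps <= mass z q ->
  (forall D, D \subset N -> disjoint_family d D ->
     (1 - eps) * #|D|%:R <= \sum_(q in D) mass z q + mov) ->
  forall D, D \subset q |: N -> disjoint_family d D ->
     (1 - eps) * #|D|%:R <= \sum_(q in D) mass z q + mov.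
Proof.
move=> hq pN D DN dD; have [qD|qD] := boolP (q \in D); last first.
  by apply: pN => //; apply/subsetP => a aD; have := subsetP DN a aD;
     rewrite !inE => /predU1P[ae|//]; rewrite -ae aD in qD.
have h : D :\ q \subset N.
  by apply/subsetP => a; rewrite !inE => /andP[ne aD]; have := subsetP DN a aD;
     rewrite !inE (negPf ne).
have h2 := pN _ h (disjoint_familyS (subsetDl _ _) dD).
rewrite [\sum_(_ in D) _](big_setD1 q) //=.
have -> : #|D|%:R = 1 + #|D :\ q|%:R :> R by rewrite (cardsD1 q D) qD natrD.
by rewrite mulrDr mulr1; lra.
Qed.

(** If [q] meets a smaller site of [S], that site represents it; otherwise [q] joins and evicts the
    larger ones it meets. A representative is only ever replaced by one of at most half the radius,
    so the distances of successive evictions telescope within [3 * rad n.2]. Evictions are paid by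
    the decrease of [#|S|]. *)
Lemma add_site N S z mov q : epoch_inv N S z mov -> 1 - eps <= mass z q ->
  (forall n, n \in N -> n.2 = q.2 -> ~~ meets d q n) ->
  exists S', epoch_inv (q |: N) S' z mov /\
    (#|symdiff S' S| + #|S'| <= #|S| + 2)%N.
Proof.
move=> [sN /andP[SN dS] cN pN] hq far.
have sN' : separated d (q |: N).
  apply/separatedP => a b; rewrite !inE => /predU1P[->|aN] /predU1P[->|bN] // eab m.
  - by rewrite (negPf (far b bN (esym eab))) in m.
  - by rewrite meets_sym // (negPf (far a aN eab)) in m.
  - exact: (separatedP _ _ sN).
have pN' := epoch_packing hq pN.
have [/existsP[q' /and3P[q'S lt m]]|no] :=
    boolP [exists q', [&& q' \in S, (q'.2 < q.2)%N & meets d q q']].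
  exists S; split; last by rewrite card_symdiff setDv cards0 addn0 add0n leq_addr.
  split=> //; first by rewrite dS andbT; apply: subset_trans SN (subsetUr _ _).
  move=> n; rewrite !inE => /predU1P[->|/cN //]; exists q' => //.
  by have h := rad_double (R:=R) lt; rewrite /meets in m; lra.
have big q' : q' \in S -> meets d q q' -> (q.2 < q'.2)%N.
  move=> q'S m; rewrite ltnNge leq_eqVlt; apply/negP => /orP[/eqP/val_inj e|lt].
    by have := far q' (subsetP SN _ q'S) e; rewrite m.
  by case/existsP: no; exists q'; rewrite q'S lt.
pose X := [set q' in S | meets d q q'].
have qS : q \notin S.
  by apply/negP => /(subsetP SN) qN; have := far q qN erefl; rewrite meets_refl.
exists (q |: (S :\: X)); split.
  split=> //.
  - apply/andP; split.
      rewrite subUset sub1set setU11 /=; apply: subset_trans (subsetDl _ _) _.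
      exact: subset_trans SN (subsetUr _ _).
    apply/disjoint_familyP => a b; rewrite !inE => /predU1P[->|/andP[aX aS]]
      /predU1P[->|/andP[bX bS]] // m.
    + by rewrite bS m in bX.
    + by rewrite aS meets_sym // m in aX.
    + exact: (disjoint_familyP _ _ dS).
  - move=> n; rewrite !inE => /predU1P[->|nN].
      exists q; first exact: setU11.
      by rewrite (metric_eq0 dm q.1 q.1).2 // add0r.
    have [q' q'S h] := cN n nN; have [m|m] := boolP (meets d q q'); last first.
      by exists q' => //; rewrite !inE q'S m orbT.
    exists q; first exact: setU11.
    have h1 := rad_double (R:=R) (big q' q'S m).
    have h2 := metric_triangle dm n.1 q'.1 q.1.
    by rewrite /meets (metric_sym dm) in m; lra.
have XS : X \subset S by apply/subsetP => a; rewrite inE => /andP[].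
have c1 : #|q |: (S :\: X)| = (#|S| - #|X|).+1.
  by rewrite cardsU1 cardsDS // inE (negPf qS) andbF.
have c2 : (#|symdiff (q |: (S :\: X)) S| <= #|X|.+1)%N.
  apply: (@leq_trans #|q |: X|); last by rewrite cardsU1; case: (_ \notin _).
  apply: subset_leq_card; apply/subsetP => a; rewrite !inE.
  by case: (a == q); case: (a \in S); case: (meets d q a).
have c3 := subset_leq_card XS; lia.
Qed.

Lemma saturate N S z mov : epoch_inv N S z mov ->
  exists N' S', [/\ epoch_inv N' S' z mov, saturated N' z &
    (#|symdiff S' S| + #|S'| + 2 * #|N| <= #|S| + 2 * #|N'|)%N].
Proof.
have [n] := ubnP #|~: N|; elim: n N S => // n IH N S hn inv.
have [/existsP[q /andP[hq /forallP far]]|no] := boolP [exists q : site,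
    (1 - eps <= mass z q) && [forall m, ~~ [&& m \in N, m.2 == q.2 & meets d q m]]]; last first.
  exists N, S; split=> //; last by rewrite card_symdiff setDv cards0.
  move=> q hq; move: no; rewrite negb_exists => /forallP /(_ q); rewrite hq /=.
  by rewrite negb_forall => /existsP[m]; rewrite negbK => /and3P[mN /eqP e m']; exists m.
have far' m : m \in N -> m.2 = q.2 -> ~~ meets d q m.
  by move=> mN e; have := far m; rewrite mN e eqxx.
have qN : q \notin N by apply/negP => /far' /(_ erefl); rewrite meets_refl.
have [S1 [inv1 c1]] := add_site inv hq far'.
have [|N2 [S2 [inv2 sat2 c2]]] := IH _ _ _ inv1.
  rewrite ltnS in hn; apply: leq_trans hn; apply: proper_card; apply/properP; split.
    by rewrite setCS subsetUr.
  by exists q; rewrite !inE ?eqxx.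
exists N2, S2; split=> //.
have c3 := symdiff_triangle S2 S1 S; rewrite cardsU1 qN in c2; lia.
Qed.

(** Each level of [N] is disjoint, and [1 - eps >= 1 / 2]. *)
Lemma epoch_card N S z mov : epoch_inv N S z mov -> (forall p, 0 <= z p) -> 0 <= mov ->
  #|N|%:R <= 2 * L.+1%:R * (\sum_p z p + mov).
Proof.
have [e0 e1] := (eps0, eps1).
move=> [/forallP sN _ _ pN] z0 mov0.
have -> : #|N| = (\sum_(l < L.+1) #|[set q in N | q.2 == l]|)%N.
  rewrite -sum1_card (partition_big (fun q : site => q.2) predT) //=.
  by apply: eq_bigr => l _; rewrite -sum1_card; apply: eq_bigl => q; rewrite inE.
rewrite natr_sum [2 * _]mulrC -mulrA mulr_natl -[X in _ *+ X](card_ord L.+1) -sumr_const.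
apply: ler_sum => l _.
have sub : [set q in N | q.2 == l] \subset N by apply/subsetP => q; rewrite inE => /andP[].
have h1 := pN _ sub (sN l); have h2 := disjoint_mass dm (sN l) z0.
set X := #|_|%:R in h1 *; have X0 : 0 <= X by rewrite ler0n.
have h3 : 1 / 2 * X <= (1 - eps) * X by rewrite ler_wpM2r //; lra.
lra.
Qed.

(** The terms in [#|N|] and [#|S|] pay for additions and evictions, the total mass helps keep the
    potential nonnegative, and the movement term saves up for the next reset. *)
Definition epoch_potential N S z mov : R :=
  8 * L.+1%:R / eps * mov + 4 * L.+1%:R * \sum_p z p - 2 * #|N|%:R + #|S|%:R.

Lemma epoch_potential_ge0 N S z mov : epoch_inv N S z mov -> (forall p, 0 <= z p) ->
  0 <= mov -> 0 <= epoch_potential N S z mov.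
Proof.
have [e0 e1] := (eps0, eps1).
move=> inv z0 mov0; have h := epoch_card inv z0 mov0; rewrite /epoch_potential.
have h2 : 4 * L.+1%:R * mov <= 8 * L.+1%:R / eps * mov.
  rewrite ler_wpM2r // ler_pdivlMr //.
  have h3 : 0 <= L.+1%:R * (8 - 4 * eps) by rewrite mulr_ge0 //; lra.
  lra.
have h4 : 0 <= #|S|%:R :> R by rewrite ler0n.
lra.
Qed.

Lemma center_round_step N S z mov z' : epoch_inv N S z mov ->
  (forall p, 0 <= z p) -> (forall p, 0 <= z' p) ->
  \sum_p z p <= (1 + eps) * k%:R -> 0 <= mov <= eps * k%:R ->
  exists N' S' mov', [/\ epoch_inv N' S' z' mov', 0 <= mov' <= eps * k%:R, saturated N' z' &
    #|symdiff S' S|%:R + epoch_potential N' S' z' mov' <=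
      epoch_potential N S z mov + (8 / eps + 4) * L.+1%:R * l1dist z' z].
Proof.
have [e0 e1] := (eps0, eps1).
move=> inv z0 z0' zk /andP[mov0 movk].
have hN := epoch_card inv z0 mov0.
pose mov1 := mov + l1dist z' z.
have l10 : 0 <= l1dist z' z by apply: sumr_ge0.
have inv1 : epoch_inv N S z' mov1.
  have [h1 h2 h3 pN] := inv; split=> // D DN dD; apply: le_trans (pN D DN dD) _.
  rewrite /mov1 addrA addrAC lerD2r -lerBlDl -sumrB.
  apply: le_trans (disjoint_mass dm dD (fun p => normr_ge0 (z' p - z p))).
  apply: ler_sum => q _; apply: le_trans (ler_norm _) _; rewrite distrC; exact: mass_sub.
have pot1 : epoch_potential N S z' mov1 <=
    epoch_potential N S z mov + (8 / eps + 4) * L.+1%:R * l1dist z' z.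
  have h1 : \sum_p z' p <= \sum_p z p + l1dist z' z.
    by rewrite -big_split; apply: ler_sum => p _ /=; rewrite -lerBlDl ler_norm.
  have h2 := ler_wpM2l (ler0n R L.+1) h1.
  rewrite /epoch_potential /mov1 !mulrDr !mulrDl.
  rewrite mulrDr in h2; lra.
have [small|large] := lerP mov1 (eps * k%:R).
  have [N' [S' [inv' sat c]]] := saturate inv1.
  exists N', S', mov1; split=> //; first by rewrite addr_ge0.
  apply: le_trans pot1; rewrite /epoch_potential.
  have c' : #|symdiff S' S|%:R + #|S'|%:R + 2 * #|N|%:R <= #|S|%:R + 2 * #|N'|%:R :> R.
    by rewrite -!natrM -!natrD ler_nat.
  lra.
have inv2 : epoch_inv set0 set0 z' 0.
  split=> [||n|D]; rewrite ?inE ?sub0set //.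
  - by apply/separatedP => q q'; rewrite inE.
  - by apply/disjoint_familyP => q q'; rewrite inE.
  - by rewrite subset0 => /eqP-> _; rewrite cards0 mulr0 big_set0 addr0.
have [N' [S' [inv' sat c]]] := saturate inv2.
exists N', S', 0; split=> //; first by rewrite lexx mulr_ge0 // ltW.
apply: le_trans pot1.
have c3 : (#|symdiff S' S| <= #|symdiff S' set0| + #|S|)%N.
  apply: leq_trans (symdiff_triangle S' set0 S) _.
  by rewrite leq_add2l card_symdiff set0D setD0 cards0.
have c4 : #|symdiff S' S|%:R + #|S'|%:R <= #|S|%:R + 2 * #|N'|%:R :> R.
  by rewrite !cards0 in c; rewrite -natrM -!natrD ler_nat; lia.
(* A reset forfeits [- 2 * #|N|]. The net had size at most [4 * L.+1%:R * k%:R], and the movement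
   term is now at least twice that. *)
have c5 : 2 * #|N|%:R <= 8 * L.+1%:R / eps * mov1.
  have h1 : 8 * L.+1%:R / eps * (eps * k%:R) <= 8 * L.+1%:R / eps * mov1.
    by rewrite ler_wpM2l ?(ltW large) // divr_ge0 ?mulr_ge0 // ltW.
  rewrite mulrA divfK ?gt_eqF // in h1.
  have h2 : \sum_p z p + mov <= 2 * k%:R.
    have : eps * k%:R <= 1 / 2 * k%:R by rewrite ler_wpM2r.
    by move=> h; lra.
  have h3 := ler_wpM2l (ler0n R L.+1) h2; lra.
rewrite /epoch_potential; lra.
Qed.

Lemma epoch_centers N S z mov : epoch_inv N S z mov -> (forall p, 0 <= z p) ->
  \sum_p z p <= (1 + eps) * k%:R -> mov <= eps * k%:R ->
  (1 - eps) * #|fst @: S|%:R <= (1 + 2 * eps) * k%:R.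
Proof.
have [e0 e1] := (eps0, eps1).
move=> [_ /andP[SN dS] _ pN] z0 zk mk; have h1 := pN S SN dS.
have h2 := disjoint_mass dm dS z0.
have h3 : (1 - eps) * #|fst @: S|%:R <= (1 - eps) * #|S|%:R.
  by rewrite ler_wpM2l ?ler_nat ?leq_imset_card //; lra.
lra.
Qed.

(** 5 = 2 + 3: the net site [n] is within [2 * rad l] of [j], and its representative in [S] within
    [3 * rad l] of [n]. *)
Lemma saturated_cover N S z mov : epoch_inv N S z mov -> saturated N z ->
  forall j l, 1 - eps <= mass z (j, l) -> exists2 s, s \in fst @: S & d s j <= 5 * rad l.
Proof.
move=> [_ _ cN _] sat j l hm; have [n [nN el m]] := sat _ hm.
have [q qS h] := cN n nN; exists q.1; first exact: imset_f.
move: m h; rewrite /meets el /= => m h.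
have t := metric_triangle dm q.1 n.1 j; have r := rad_ge0 (R:=R) q.2.
by rewrite (metric_sym dm q.1 n.1) (metric_sym dm n.1 j) in t; lra.
Qed.

End CenterRounding.

(** * The k-center algorithm *)

Section CenterAlgorithm.
Context {R : realType} {M : finType}.
Variables (d : M -> M -> R) (L k : nat) (eps gam : R).
Hypothesis dm : is_metric d.
Hypotheses (eps0 : 0 < eps) (eps1 : eps <= 1 / 2).
Hypotheses (gam0 : 0 < gam) (gam1 : gam <= 1) (gamM : 8 * gam * #|M|%:R <= eps).
Implicit Types (C S u : {set M}) (V : pred {set M}) (z : M -> R).

Definition center_budget V z : Prop := \sum_p z p <= (1 + eps) * k%:R /\
  forall q : site (M:=M) L, (forall u, V u -> u :&: ball d q != set0) -> 1 - eps <= mass d z q.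

Lemma center_fractional_step V z : (exists u, V u) -> (forall u, V u -> (#|u| <= k)%N) ->
  (forall i, 0 <= z i <= 2) ->
  exists z', [/\ center_budget V z', forall i, 0 <= z' i <= 2 &
    forall u, V u -> divergence gam u z' + eps / 4 * l1dist z' z <= divergence gam u z].
Proof.
have [e0 e1] := (eps0, eps1).
move=> Vn Vk zb; pose A := [set i | [exists u, V u && (i \in u)]].
have AV i : i \in A -> exists2 u, V u & i \in u.
  by rewrite inE => /existsP[u /andP[Vu iu]]; exists u.
have VA u : V u -> u \subset A.
  by move=> Vu; apply/subsetP => i iu; rewrite inE; apply/existsP; exists u; rewrite Vu.
have e1' : eps <= 1 by lra.
have gA : 8 * gam * #|A|%:R <= eps.
  apply: le_trans gamM; rewrite ler_wpM2l ?ler_nat ?max_card //.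
  by rewrite mulr_ge0 // ltW.
have [|z' [gz' [zb' zA] pz']] := @chase _ _ gam gam0 gam1 eps A V e0 e1' gA VA
    (center_budget V) z Vn AV _ zb; last first.
  by exists z'; split=> // u Vu; have := pz' u Vu; rewrite addr0.
move=> {zb}z [zb zA].
have [|ns] := pselect (separable eps V z); first by right.
left; split=> [|q hq]; rewrite leNgt; apply/negP => hz; apply: ns.
(* The packing weights are [1 / k]. If [k = 0], then [A] is empty and [z] vanishes. *)
- have [k0|kp] := posnP k.
    have : \sum_p z p = 0.
      rewrite big1 // => i _; apply: zA; apply/negP => /AV[u Vu iu].
      by have := Vk u Vu; rewrite k0 leqn0 cards_eq0 => /eqP u0; rewrite u0 inE in iu.
    by move=> h; move: hz; rewrite h k0 mulr0 ltxx.
  have kp' : 0 < k%:R :> R by rewrite ltr0n.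
  right; exists (fun=> k%:R^-1); split.
  + by move=> i; rewrite invr_ge0 ltW.
  + move=> u Vu; rewrite sumr_const -[leLHS]mulr_natl ler_pdivrMr // mul1r ler_nat; exact: Vk.
  + by rewrite -mulr_sumr mulrC ler_pdivlMr // ltW.
- left; exists (fun i => (i \in ball d q)%:R); split.
  + by move=> i; rewrite ler0n ler_nat; case: (_ \in _).
  + move=> u /hq /set0Pn[i]; rewrite inE => /andP[iu ib].
    by rewrite (bigD1 i) //= ib lerDl; apply: sumr_ge0 => i' _; rewrite ler0n.
  + apply: le_trans (ltW hz); rewrite /mass [leRHS]big_mkcond; apply: ler_sum => i _.
    by case: (_ \in _); rewrite ?mul1r ?mul0r.
Qed.

Definition center_state : Type :=
  ((M -> R) * ({set site (M:=M) L} * {set site (M:=M) L} * R))%type.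
Implicit Type st : center_state.
Definition center_out st : {set M} := fst @: st.2.1.2.
Definition center_inv st : Prop :=
  [/\ forall i, 0 <= st.1 i <= 2, \sum_p st.1 p <= (1 + eps) * k%:R,
      0 <= st.2.2 <= eps * k%:R & epoch_inv d eps st.2.1.1 st.2.1.2 st.1 st.2.2].
(** The coefficient satisfies [48 / eps ^+ 2 * (eps / 4) = 12 / eps], which exceeds the rounding
    rate [8 / eps + 4]. *)
Definition center_potential u st : R :=
  48 / eps ^+ 2 * L.+1%:R * divergence gam u st.1 +
  epoch_potential eps st.2.1.1 st.2.1.2 st.1 st.2.2.

Lemma center_step V st : (exists u, V u) -> (forall u, V u -> (#|u| <= k)%N) ->
  center_inv st -> exists st', [/\ center_inv st',
    forall j (l : 'I_L.+1), (forall u, V u -> u :&: ball d (j, l) != set0) ->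
      exists2 s, s \in center_out st' & d s j <= 5 * rad l &
    forall u, V u -> #|symdiff (center_out st') (center_out st)|%:R + center_potential u st' <=
      center_potential u st].
Proof.
have [e0 e1] := (eps0, eps1).
move=> Vn Vk; case: st => z [[N S] mov] [/= zb zk mk inv].
have [z' [[b1 b2] zb' pz]] := center_fractional_step Vn Vk zb.
have z0 i : 0 <= z i by case/andP: (zb i).
have z0' i : 0 <= z' i by case/andP: (zb' i).
have [N' [S' [mov' [inv' mk' sat pot]]]] := center_round_step dm eps0 eps1 inv z0 z0' zk mk.
exists (z', ((N', S'), mov')); split=> //.
  by move=> j l hq; apply: (saturated_cover dm inv' sat); apply: b2.
move=> u Vu; rewrite /center_out /center_potential /=.
have c0 : 0 <= 48 / eps ^+ 2 * L.+1%:R by rewrite mulr_ge0 // divr_ge0 // exprn_ge0 // ltW.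
have h1 := ler_wpM2l c0 (pz u Vu); rewrite mulrDr in h1.
have h2 : #|symdiff (fst @: S') (fst @: S)|%:R <= #|symdiff S' S|%:R :> R.
  by rewrite ler_nat card_symdiff_imset.
have h3 : (8 / eps + 4) * L.+1%:R * l1dist z' z <=
    48 / eps ^+ 2 * L.+1%:R * (eps / 4 * l1dist z' z).
  have -> : 48 / eps ^+ 2 * L.+1%:R * (eps / 4 * l1dist z' z) =
      12 / eps * (L.+1%:R * l1dist z' z) by field; rewrite gt_eqF.
  rewrite -mulrA ler_wpM2r //; first by rewrite mulr_ge0 // sumr_ge0.
  have -> : 12 / eps = 8 / eps + 4 / eps by field; rewrite gt_eqF.
  rewrite lerD2l ler_pdivlMr //; lra.
lra.
Qed.

End CenterAlgorithm.

Lemma center_competitive (R : realType) (M : finType) (d : M -> M -> R) (L k : nat)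
    (eps gam : R) (cost : {set M} -> {set M} -> \bar R)
    (feas allowed : pred {set M}) (gamma beta rho : R) :
  is_metric d -> 0 < eps -> eps <= 1 / 2 -> 0 < gam -> gam <= 1 ->
  8 * gam * #|M|%:R <= eps ->
  0 < rho -> 48 / eps ^+ 2 * L.+1%:R * (3 - ln gam) <= rho ->
  (forall C, exists u, feas u && approximate cost feas beta C u) ->
  (forall u, feas u -> (#|u| <= k)%N) ->
  (forall S : {set M}, (1 - eps) * #|S|%:R <= (1 + 2 * eps) * k%:R -> allowed S) ->
  (forall C S : {set M}, (forall j (l : 'I_L.+1),
       (forall u, feas u -> approximate cost feas beta C u -> u :&: ball d (j, l) != set0) ->
       exists2 s, s \in S & d s j <= 5 * rad l) ->
    approximate cost feas gamma C S) ->
  competitive cost feas allowed gamma beta rho.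
Proof.
move=> dm eps0 eps1 gam0 gam1 gamM rho0 hrho Vn Vk hallowed happrox.
apply: (@competitive_of_potential _ _ cost feas allowed gamma beta rho _
  ((fun=> 0), ((set0, set0), 0)) (@center_out R M L) (center_inv d k eps)
  (center_potential eps gam)) => //.
- split=> /= [i|||]; first by rewrite lexx ler0n.
  + by rewrite big1 // mulr_ge0 // addr_ge0 // ltW.
  + by rewrite lexx mulr_ge0 // ltW.
  + split=> [||n|D]; rewrite ?inE ?sub0set //.
    * by apply/separatedP => q q'; rewrite inE.
    * by apply/disjoint_familyP => q q'; rewrite inE.
    * by rewrite subset0 => /eqP-> _; rewrite cards0 mulr0 big_set0 addr0.
- by rewrite /center_out imset0.
- rewrite /center_potential /divergence big1 ?mulr0 ?add0r; last first.
    by move=> i _; rewrite inE.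
  by rewrite /epoch_potential big1 // !cards0 !mulr0 subr0 !addr0.
- move=> u st [zb _ /andP[m0 _] inv]; have z0 i : 0 <= st.1 i by case/andP: (zb i).
  rewrite addr_ge0 //; last exact: (epoch_potential_ge0 dm eps0 eps1 inv z0 m0).
  by rewrite !mulr_ge0 ?divergence_ge0 // invr_ge0 exprn_ge0 // ltW.
- move=> u u' st [zb _ _ _]; rewrite /center_potential addrAC lerD2r.
  have c0 : 0 <= 48 / eps ^+ 2 * L.+1%:R by rewrite mulr_ge0 // divr_ge0 // exprn_ge0 // ltW.
  have h := ler_wpM2l c0 (divergence_switch gam0 gam1 u u' zb).
  have h2 : 48 / eps ^+ 2 * L.+1%:R * (3 - ln gam) * #|symdiff u u'|%:R <=
      rho * #|symdiff u u'|%:R by rewrite ler_wpM2r.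
  by rewrite mulrDr mulrA in h; lra.
- move=> st C hst.
  have [st' [inv' cov pot']] := center_step dm eps0 eps1 gam0 gam1 gamM (Vn C)
     (fun u Vu => Vk u (andP Vu).1) hst.
  exists st'; split=> //.
  + have [zb zk /andP[_ mk] inv] := inv'; apply: hallowed.
    by apply: (epoch_centers dm eps0 eps1 inv _ zk mk) => i; case/andP: (zb i).
  + by apply: happrox => j l h; apply: cov => u /andP[]; apply: h.
  + by move=> u fu au; apply: pot'; rewrite fu.
Qed.

(** * Optimal costs, levels and constants *)

Section Optimum.
Context {R : realType} {M : finType}.
Variables (cost : {set M} -> {set M} -> \bar R) (feas : pred {set M}).
Hypothesis cost_ge0 : forall C S, feas S -> (0 <= cost C S)%E.
Hypothesis feas0 : feas set0.

Lemma opt_cost_ge0 C : (0 <= opt_cost cost feas C)%E.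
Proof.
rewrite /opt_cost; elim/big_ind: _ => [|x y hx hy|S fS]; first exact: leey.
  by rewrite le_min hx.
exact: cost_ge0.
Qed.

(** The optimum is attained unless it is infinite, and then the empty set qualifies. *)
Lemma approximate_optimum (beta : R) C : 1 <= beta ->
  exists u, feas u && approximate cost feas beta C u.
Proof.
move=> b1.
have : opt_cost cost feas C = +oo%E \/
    exists2 S, feas S & cost C S = opt_cost cost feas C.
  rewrite /opt_cost; elim/big_ind: _ => [|x y hx hy|S fS]; first by left.
    by rewrite /mine; case: ifP.
  by right; exists S.
rewrite /approximate => -[h|[S fS h]].
  by exists set0; rewrite feas0 h gt0_muley ?leey // lte_fin (lt_le_trans _ b1).
exists S; rewrite fS h /=; have := opt_cost_ge0 C.
by move=> o0; rewrite -[leLHS]mul1e lee_wpmul2r // lee_fin.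
Qed.

(* Everything approximates an infinite optimum. *)
Lemma approximate_finite (gamma : R) C S : 0 < gamma ->
  (forall r : R, 0 <= r -> opt_cost cost feas C = r%:E -> (cost C S <= (gamma * r)%:E)%E) ->
  approximate cost feas gamma C S.
Proof.
move=> g0 h; rewrite /approximate; have := opt_cost_ge0 C; have := h.
case: (opt_cost cost feas C) => [r h' r0|_ _|_ //]; last by rewrite gt0_muley ?leey ?lte_fin.
by rewrite -EFinM; apply: h' => //; rewrite lee_fin in r0.
Qed.

Lemma approximate_le (beta r : R) C u : opt_cost cost feas C = r%:E ->
  approximate cost feas beta C u -> (cost C u <= (beta * r)%:E)%E.
Proof. by rewrite /approximate => ->; rewrite EFinM. Qed.

End Optimum.

(** * Levels and the aspect ratio *)

Section MetricLevels.
Context {R : realType} {M : finType}.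
Variable d : M -> M -> R.
Hypotheses (dm : is_metric d) (dn : normalized d).

Lemma normalized_min i j : i != j -> 1 <= d i j.
Proof.
move=> ij; rewrite -lee_fin -dn.
by rewrite (bigD1 (i, j)) //= ge_min lexx.
Qed.

Lemma aspect_ratio_ge i j : d i j <= aspect_ratio d.
Proof. by rewrite /aspect_ratio (bigD1 (i, j)) //= le_max lexx. Qed.

Lemma normalized_pair : exists i j : M, i != j.
Proof.
have [/existsP[i /existsP[j ij]]|] := boolP [exists i : M, exists j : M, i != j].
  by exists i, j.
rewrite negb_exists => /forallP no; have := dn.
rewrite /normalized big_pred0 // => -[i j] /=; apply: negbTE.
by have := no i; rewrite negb_exists => /forallP.
Qed.

Lemma aspect_ratio_ge1 : 1 <= aspect_ratio d.
Proof.
have [i [j /normalized_min h]] := normalized_pair.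
exact: le_trans h (aspect_ratio_ge i j).
Qed.

Lemma card_normalized : (2 <= #|M|)%N.
Proof.
have [i [j ij]] := normalized_pair; rewrite -cardsT.
by have := subset_leq_card (subsetT [set i; j]); rewrite cards2 ij.
Qed.

Lemma ln2_ge : 1 / 2 <= ln 2 :> R.
Proof.
have h0 : 0 < 2^-1 :> R by rewrite invr_gt0.
by have := ln_le_subr1 h0; rewrite lnV ?posrE // => h; lra.
Qed.

(** With [m] least such that the aspect ratio is at most [2 ^+ m], take [L = m + 1]; minimality and
    [ln 2 >= 1 / 2] bound it. *)
Lemma levels_exist : exists L : nat, (forall i j, d i j <= rad L) /\
  L.+1%:R <= 3 * (1 + ln (aspect_ratio d)).
Proof.
have D1 := aspect_ratio_ge1; set D := aspect_ratio d in D1 *.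
have D0 : 0 < D by lra.
have lnD : 0 <= ln D by rewrite ln_ge0.
have ex : exists m : nat, D <= 2 ^+ m.
  exists (Num.bound D); apply: ltW; apply: lt_le_trans (archi_boundP (ltW D0)) _.
  by rewrite -natrX ler_nat ltnW // ltn_expl.
case: (ex_minnP ex) => m hm minm; exists m.+1; split=> [i j|] /=.
  exact: le_trans (aspect_ratio_ge i j) hm.
case: m hm minm => [|m] hm minm; first by lra.
have : ~~ (D <= 2 ^+ m) by apply/negP => /minm; rewrite ltnn.
rewrite -ltNge -ltr_ln ?posrE ?exprn_gt0 // lnXn // -[_ *+ m]mulr_natr => h.
have h2 := ler_wpM2r (ler0n R m) ln2_ge.
have -> : m.+3%:R = m%:R + 3 :> R by rewrite -addn3 natrD.
lra.
Qed.

(** Below 1 the only distance is 0, so level 0 serves; otherwise the first radius reaching [r],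
    capped at level [L], is at most [2 * r]. *)
Lemma level_of_radius (L : nat) (r : R) : (forall i j, d i j <= rad L) -> 0 <= r ->
  exists l : 'I_L.+1, (forall i j, d i j <= r -> d i j <= rad l) /\ rad l <= 2 * r.
Proof.
move=> dmax r0; have [r1|r1] := ltP r 1.
  exists ord0; split=> [i j h|]; last by rewrite /= mulr_ge0.
  have [->|/normalized_min h2] := eqVneq i j; first by rewrite (metric_eq0 dm j j).2.
  by exfalso; lra.
have ex : exists l, (r <= rad l) || (l == L) by exists L; rewrite eqxx orbT.
case: (ex_minnP ex) => l hl minl.
have lL : (l < L.+1)%N by rewrite ltnS minl // eqxx orbT.
exists (Ordinal lL); split=> /= [i j h|].
  by case/orP: hl => [h2|/eqP->//]; apply: le_trans h h2.
case: l hl minl lL => [|l] hl minl lL /=; first by rewrite mulr_ge0.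
have : ~~ (r <= rad l) by apply/negP => h; have := minl l; rewrite h ltnn => /(_ isT).
rewrite -ltNge; case: l {hl minl lL} => [|l] /= h; first by lra.
by rewrite exprS; lra.
Qed.

End MetricLevels.

(** * Constants for the three objectives *)

Section Competitiveness.
Context {R : realType} {M : finType}.
Variables (d : M -> M -> R) (beta : R).
Hypotheses (dm : is_metric d) (dn : normalized d) (beta1 : 1 <= beta).
Implicit Types C S u : {set M}.

Lemma ln2_le1 : ln 2 <= 1 :> R.
Proof. by apply: le_trans (ln_le_subr1 _) _; rewrite ?ltr0n //; lra. Qed.

Lemma ln_pow2_mul (n : nat) (x : R) : 0 < x -> ln (2 ^+ n * x) <= n%:R + ln x.
Proof.
move=> x0; rewrite lnM ?posrE ?exprn_gt0 // lnXn // lerD2r -[_ *+ n]mulr_natl.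
by rewrite ler_piMr // ln2_le1.
Qed.

Lemma sum_cost_rate (F : {set M}) : exists gam : R,
  [/\ 0 < gam, gam <= 1, 16 * gam * #|F|%:R <= 1 & 3 - ln gam <= 8 + ln #|F|%:R].
Proof.
have n0 : 0 < #|F|.+1%:R :> R by rewrite ltr0n.
have n1 : 1 <= #|F|.+1%:R :> R by rewrite ler1n.
have p0 : 0 < 2 ^+ 4 * #|F|.+1%:R :> R by rewrite mulr_gt0 // exprn_gt0.
have E16 : 2 ^+ 4 = 16 :> R by rewrite -natrX.
(* The successor keeps [gam] positive when [F] is empty. *)
exists (2 ^+ 4 * #|F|.+1%:R)^-1; split.
- by rewrite invr_gt0.
- by rewrite invf_le1 // E16; lra.
- by rewrite mulrAC ler_pdivrMr // mul1r E16 ler_pM2l // ler_nat.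
- rewrite lnV ?posrE // opprK; have h := ln_pow2_mul 4 n0.
  suff h2 : ln #|F|.+1%:R <= 1 + ln #|F|%:R :> R by lra.
  case: (posnP #|F|) => [->|f0]; first by rewrite ln1 ln0 // addr0.
  have := ln_pow2_mul 1 (_ : 0 < #|F|%:R :> R); rewrite ltr0n => /(_ f0).
  apply: le_trans; rewrite ler_ln ?posrE ?mulr_gt0 ?ltr0n // expr1 -natrM ler_nat.
  by rewrite mul2n -addnn -addn1 leq_add2l.
Qed.

Lemma facility_location_competitive (K : R) (F : {set M}) (f : M -> R) :
  400 * 250 <= K -> (forall i, i \in F -> 0 <= f i) ->
  competitive (facility_cost d f) (centers_in F) (centers_in F) (K * beta) beta
    (K * ((1 + ln #|F|%:R) * (1 + ln (aspect_ratio d)))).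
Proof.
(* [f] may be negative outside [F], whereas the rounding needs nonnegative weights everywhere. *)
move=> hK f0; pose g i := if i \in F then f i else 0.
have b1 := beta1.
have g0 i : 0 <= g i by rewrite /g; case: ifP => // /f0.
have costE C S : S \subset F ->
    facility_cost d f C S = ((\sum_(i in S) g i)%:E + kmedian_cost d C S)%E.
  move=> SF; rewrite /facility_cost -sumEFin; congr (_ + _)%E.
  by apply: eq_bigr => i /(subsetP SF) iF; rewrite /g iF.
have gS S : 0 <= \sum_(i in S) g i by apply: sumr_ge0.
have cost0 C S : centers_in F S -> (0 <= facility_cost d f C S)%E.
  by move=> SF; rewrite costE // adde_ge0 ?lee_fin ?kmedian_cost_ge0.
have feas0 : centers_in F set0 by rewrite /centers_in sub0set.
have [L [dmax hL]] := levels_exist dn.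
have [gam [gam0 gam1 gamF hgam]] := sum_cost_rate F.
have lnD : 0 <= ln (aspect_ratio d) by rewrite ln_ge0 // aspect_ratio_ge1.
have lnF : 0 <= ln #|F|%:R :> R.
  by case: (posnP #|F|) => [->|h]; [rewrite ln0|rewrite ln_ge0 // ler1n].
have lng : ln gam <= 0 by rewrite ln_le0.
apply: (@sum_cost_competitive R M d L F g gam) => //.
- exact: normalized_min.
- by rewrite !mulr_gt0 //; lra.
- set X := 1 + ln (aspect_ratio d) in hL *; set Y := ln #|F|%:R in hgam lnF *.
  have h1 : L.+1%:R * (3 - ln gam) <= 3 * X * (8 + Y) by rewrite ler_pM //; lra.
  have X0 : 0 <= X by rewrite /X; lra.
  have h2 : 0 <= X * Y by rewrite mulr_ge0.
  have h3 : 400 * 250 * ((1 + Y) * X) <= K * ((1 + Y) * X).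
    by rewrite ler_wpM2r // mulr_ge0 //; lra.
  lra.
- by move=> C; apply: approximate_optimum.
- move=> C S [SF hG hB]; split=> //; apply: approximate_finite => //.
    by rewrite mulr_gt0 //; lra.
  move=> r r0 hr.
  have ub u : centers_in F u && approximate (facility_cost d f) (centers_in F) beta C u ->
      \sum_(i in u) g i <= beta * r /\ (kmedian_cost d C u <= (beta * r)%:E)%E.
    case/andP => uF /(approximate_le hr); rewrite costE // => h; split.
      by rewrite -lee_fin; apply: le_trans h; rewrite leeDl // kmedian_cost_ge0.
    by apply: le_trans h; rewrite leeDr // lee_fin.
  rewrite costE //.
  apply: (@le_trans _ _ ((144 * (beta * r))%:E + (40 * (beta * r))%:E)%E).
    apply: leeD; first by rewrite lee_fin; apply: hG => u /ub[].
    by apply: hB => u /ub[].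
  rewrite -EFinD lee_fin -mulrDl -mulrA ler_wpM2r ?mulr_ge0 //; lra.
Qed.

(** With unit opening costs, the opening budget counts centers: at most [144 * k] are opened. *)
Lemma kmedian_competitive (K : R) (k : nat) : 400 * 250 <= K ->
  let F := [set: M]%SET in
  competitive (kmedian_cost d) (at_most_centers F (k%:R : R))
    (at_most_centers F (K * k%:R)) (K * beta) beta
    (K * (ln #|F|%:R * (1 + ln (aspect_ratio d)))).
Proof.
move=> hK F; have b1 := beta1.
have cost0 C S : at_most_centers F (k%:R : R) S -> (0 <= kmedian_cost d C S)%E.
  by move=> _; apply: kmedian_cost_ge0.
have feas0 : at_most_centers F (k%:R : R) set0.
  by rewrite /at_most_centers sub0set cards0 ler0n.
have [L [dmax hL]] := levels_exist dn.
have [gam [gam0 gam1 gamF hgam]] := sum_cost_rate F.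
have lnD : 0 <= ln (aspect_ratio d) by rewrite ln_ge0 // aspect_ratio_ge1.
have n2 := card_normalized dn.
(* Having two points allows [8 + Y <= 17 * Y] below, which absorbs the additive constant. *)
have lnF : 1 / 2 <= ln #|F|%:R :> R.
  apply: le_trans ln2_ge _; rewrite cardsT ler_ln ?posrE ?ler_nat ?ltr0n //.
  exact: ltnW.
have lng : ln gam <= 0 by rewrite ln_le0.
have k0 : 0 <= k%:R :> R by rewrite ler0n.
apply: (@sum_cost_competitive R M d L F (fun=> 1) gam) => //.
- exact: normalized_min.
- by rewrite !mulr_gt0 //; lra.
- set X := 1 + ln (aspect_ratio d) in hL *; set Y := ln #|F|%:R in hgam lnF *.
  have h1 : L.+1%:R * (3 - ln gam) <= 3 * X * (17 * Y) by rewrite ler_pM //; lra.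
  have X0 : 0 <= X by rewrite /X; lra.
  have h2 : 0 <= Y * X by rewrite mulr_ge0 //; lra.
  have h3 : 400 * 250 * (Y * X) <= K * (Y * X) by rewrite ler_wpM2r.
  lra.
- by move=> C; apply: approximate_optimum.
- by move=> u _; rewrite subsetT.
- move=> C S [SF hG hB]; split.
    rewrite /at_most_centers SF /=.
    have := hG k%:R; rewrite sumr_const => h.
    apply: le_trans (h _) _; last by rewrite ler_wpM2r //; lra.
    by move=> u /andP[/andP[_ hu] _]; rewrite sumr_const.
  apply: approximate_finite => //; first by rewrite mulr_gt0 //; lra.
  move=> r r0 hr; apply: le_trans (hB (beta * r) _) _.
    by move=> u /andP[_ /(approximate_le hr)].
  rewrite lee_fin -mulrA ler_wpM2r ?mulr_ge0 //; lra.
Qed.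

Lemma kcenter_competitive (K eps : R) (k : nat) : 400 * 250 <= K -> 0 < eps -> eps < 1 / 2 ->
  let F := [set: M]%SET in
  competitive (kcenter_cost d) (at_most_centers F (k%:R : R))
    (at_most_centers F ((1 + eps) * k%:R)) (K * beta) beta
    (K * (1 / eps ^+ 2 * ln (#|F|%:R / eps) * (1 + ln (aspect_ratio d)))).
Proof.
move=> hK e0 e1 F; have b1 := beta1.
have cost_ge C S x : (kcenter_cost d C S <= x)%E ->
    forall j, j \in C -> (connection_cost d S j <= x)%E.
  move=> h j jC; apply: le_trans h; rewrite /kcenter_cost (bigD1 j) //=.
  by rewrite le_max lexx.
have cost0 C S : at_most_centers F (k%:R : R) S -> (0 <= kcenter_cost d C S)%E.
  move=> _; rewrite /kcenter_cost; elim/big_ind: _ => // [x y hx hy|j _].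
    by rewrite le_max hx.
  exact: connection_cost_ge0.
have feas0 : at_most_centers F (k%:R : R) set0.
  by rewrite /at_most_centers sub0set cards0 ler0n.
have [L [dmax hL]] := levels_exist dn.
have n2 : (2 <= #|M|)%N by exact: card_normalized dn.
have n2' : 2 <= #|M|%:R :> R by rewrite ler_nat.
have lnD : 0 <= ln (aspect_ratio d) by rewrite ln_ge0 // aspect_ratio_ge1.
have ne0 : 0 < #|M|%:R / eps by rewrite divr_gt0 //; lra.
have lnF : 1 <= ln (#|M|%:R / eps).
  have h : 2 ^+ 2 <= #|M|%:R / eps.
    by rewrite ler_pdivlMr // expr2; nra.
  have := ln2_ge (R:=R); have : ln (2 ^+ 2) <= ln (#|M|%:R / eps).
    by rewrite ler_ln ?posrE ?exprn_gt0.
  by rewrite lnXn // mulr2n => *; lra.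
(* Chosen so that [8 * gam * #|M|%:R] is exactly [eps / 8]. *)
pose gam := (2 ^+ 6 * (#|M|%:R / eps))^-1.
have E64 : 2 ^+ 6 = 64 :> R by rewrite -natrX.
have p0 : 0 < 2 ^+ 6 * (#|M|%:R / eps) by rewrite mulr_gt0 // exprn_gt0.
have gam0 : 0 < gam by rewrite invr_gt0.
have ne1 : 1 <= #|M|%:R / eps by rewrite ler_pdivlMr //; lra.
have gam1 : gam <= 1 by rewrite invf_le1 // E64; lra.
have lng : ln gam <= 0 by rewrite ln_le0.
have hgam : 3 - ln gam <= 10 * ln (#|M|%:R / eps).
  by rewrite /gam lnV ?posrE // opprK; have := ln_pow2_mul 6 ne0 => ?; lra.
have e2 : 0 < eps ^+ 2 by rewrite exprn_gt0.
have k0 : 0 <= k%:R :> R by rewrite ler0n.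
(* With [eps / 8], the number of centers is at most [(1 + eps / 4) / (1 - eps / 8)] times [k], which
   is within the factor [1 + eps]. *)
apply: (@center_competitive R M d L k (eps / 8) gam) => //.
- lra.
- lra.
- rewrite /gam E64 le_eqVlt; apply/orP; left; apply/eqP; field.
  by rewrite !gt_eqF //; lra.
- by rewrite cardsT !mulr_gt0 // ?invr_gt0 //; lra.
- rewrite cardsT; set X := 1 + ln (aspect_ratio d) in hL *.
  set Y := ln (#|M|%:R / eps) in hgam lnF *.
  have h1 : L.+1%:R * (3 - ln gam) <= 3 * X * (10 * Y) by rewrite ler_pM //; lra.
  have X0 : 0 <= X by rewrite /X; lra.
  have h2 : 0 <= Y * X by rewrite mulr_ge0 //; lra.
  have h3 : 400 * 250 * (Y * X) <= K * (Y * X) by rewrite ler_wpM2r //; lra.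
  have -> : 48 / (eps / 8) ^+ 2 * L.+1%:R * (3 - ln gam) =
      eps ^- 2 * (48 * 64 * (L.+1%:R * (3 - ln gam))) by field; rewrite gt_eqF.
  have -> : K * (1 / eps ^+ 2 * Y * X) = eps ^- 2 * (K * (Y * X)).
    by field; rewrite gt_eqF.
  by rewrite ler_pM2l ?invr_gt0 //; lra.
- by move=> C; apply: approximate_optimum.
- by move=> u /andP[_]; rewrite ler_nat.
- move=> S h; rewrite /at_most_centers subsetT /=.
  have e8 : 0 < 1 - eps / 8 by lra.
  rewrite -(ler_pM2l e8); apply: le_trans h _; rewrite [leRHS]mulrA ler_wpM2r //; nra.
- move=> C S h; apply: approximate_finite => //; first by rewrite mulr_gt0 //; lra.
  move=> r r0 hr; have br : 0 <= beta * r by rewrite mulr_ge0 //; lra.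
  (* Every offline solution has a center within [beta * r] of each client, hence in its ball of
     level [l]; the algorithm then has one within [5 * rad l <= 10 * (beta * r)]. *)
  have [l [hl1 hl2]] := level_of_radius dm dn dmax br.
  have K0 : 10 * (beta * r) <= K * beta * r by rewrite -[leRHS]mulrA ler_wpM2r //; lra.
  rewrite /kcenter_cost; elim/big_ind: _ => [|x y hx hy|j jC].
  + by rewrite lee_fin; lra.
  + by rewrite ge_max hx.
  have [|s sS hs] := h j l.
    move=> u _ /(approximate_le hr) /cost_ge /(_ j jC) hu.
    have u0 : u != set0.
      by apply: contraTneq hu => ->; rewrite /connection_cost big_set0 leye_eq.
    have [s su es] := connection_cost_attained d j u0.
    apply/set0Pn; exists s; rewrite !inE su /= (metric_sym dm); apply: hl1.
    by rewrite es lee_fin in hu.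
  apply: le_trans (connection_cost_le d j sS) _; rewrite lee_fin; lra.
Qed.

End Competitiveness.

Theorem theorem1 (R : realType) :
  exists K : R, 0 < K /\
  forall beta : R, 1 <= beta ->
  [/\ (* k-center *)
      forall eps : R, 0 < eps -> eps < 1 / 2 ->
      forall (M : finType) (d : M -> M -> R) (k : nat),
        is_metric d -> normalized d ->
        let F := [set: M]%SET in
        competitive (kcenter_cost d) (at_most_centers F (k%:R : R))
          (at_most_centers F ((1 + eps) * k%:R)) (K * beta) beta
          (K * (1 / eps ^+ 2 * ln (#|F|%:R / eps) * (1 + ln (aspect_ratio d)))),
      (* facility location *)
      forall (M : finType) (d : M -> M -> R) (F : {set M}) (f : M -> R),
        is_metric d -> normalized d -> (forall i, i \in F -> 0 <= f i) ->
        competitive (facility_cost d f) (centers_in F)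
          (centers_in F) (K * beta) beta
          (K * ((1 + ln #|F|%:R) * (1 + ln (aspect_ratio d))))
    & (* k-median *)
      forall (M : finType) (d : M -> M -> R) (k : nat),
        is_metric d -> normalized d ->
        let F := [set: M]%SET in
        competitive (kmedian_cost d) (at_most_centers F (k%:R : R))
          (at_most_centers F (K * k%:R)) (K * beta) beta
          (K * (ln #|F|%:R * (1 + ln (aspect_ratio d))))].
Proof.
exists (400 * 250); split=> [|beta beta1]; first by rewrite mulr_gt0 ?ltr0n.
split.
- by move=> eps e0 e1 M d k dm dn; apply: kcenter_competitive.
- by move=> M d F f dm dn f0; apply: facility_location_competitive.
- by move=> M d k dm dn; apply: kmedian_competitive.
Qed.
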